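(* Let $n\ge 2$. A functional $\Psi:\mathcal{P}^n_0 \to \mathbb{R}$ is a measurable and $\mathrm{SL}(n)$ invariant valuation if and only if there are constants $c_0, c_0', c_n \in\mathbb{R}$ such that $$\Psi (P)= c_0\,V_0(P) +c_0'\, (-1)^{\dim P}\, \mathbf{1}_{\operatorname{relint} P} (0) + c_n\,V_n(P)$$ for every $P\in\mathcal{P}^n_0$.
   Context: $\mathcal{P}^n_0$ is the set of convex polytopes in $\mathbb{R}^n$ that contain the origin $0$, equipped with the topology induced by the Hausdorff metric. A functional on $\mathcal{P}^n_0$ is (Borel) measurable if the pre-image of every open set in $\mathbb{R}$ is a Borel set. A functional $\Psi:\mathcal{S}\to\mathbb{R}$ on a collection $\mathcal{S}$ of sets is a valuation if $\Psi(P)+\Psi(Q)=\Psi(P\cup Q)+\Psi(P\cap Q)$ whenever $P,Q,P\cap Q,P\cup Q\in\mathcal{S}$. It is $\mathrm{SL}(n)$ invariant if $\Psi(AP)=\Psi(P)$ for every $A\in\mathrm{SL}(n)$ (the real $n\times n$ matrices of determinant $1$) and $P\in\mathcal{S}$. $V_n$ is $n$-dimensional volume and $V_0$ is the Euler characteristic, i.e. $V_0(P)=1$ for every nonempty polytope $P$. $\dim P$ is the dimension of the affine hull of $P$, $\operatorname{relint} P$ is the interior of $P$ relative to its affine hull, and $\mathbf{1}_Q$ is the indicator function of $Q\subset\mathbb{R}^n$. *)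

(* Defs.v *)
From HB Require Import structures.
From mathcomp Require Import all_boot all_order all_algebra.
From mathcomp Require Import all_classical all_reals all_analysis.
From mathcomp Require Import ring.

Set Implicit Arguments.
Unset Strict Implicit.
Unset Printing Implicit Defensive.

Import Order.TTheory GRing.Theory Num.Theory.
Import numFieldNormedType.Exports.

Local Open Scope classical_set_scope.
Local Open Scope ring_scope.

Section Hulls.
Context {R : realType} {V : lmodType R}.
Implicit Types A : set V.

Definition convex_hull A : set V :=
  [set p | exists (k : nat) (a : 'I_k -> R) (x : 'I_k -> V),
     [/\ forall i, 0 <= a i, \sum_i a i = 1, forall i, A (x i) &
         p = \sum_i a i *: x i]].

Definition affine_hull A : set V :=
  [set p | exists (k : nat) (a : 'I_k -> R) (x : 'I_k -> V),
     [/\ \sum_i a i = 1, forall i, A (x i) & p = \sum_i a i *: x i]].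

Definition is_polytope A := exists2 S : set V, finite_set S & A = convex_hull S.

End Hulls.

Section Geometry.
Context {R : realType} {n : nat}.
Implicit Types A B : set 'rV[R]_n.

(* The dimension of the direction space of the affine hull. *)
Definition affine_dim A : nat :=
  get [set d | exists (x : 'rV[R]_n) (U : {vspace 'rV[R]_n}),
    affine_hull A = [set x + u | u in [set u | u \in U]] /\ d = \dim U].

Definition relint A : set 'rV[R]_n :=
  [set x | affine_hull A x /\ \forall y \near within (affine_hull A) (nbhs x), A y].

(* The library norm on 'rV[R]_n is the sup norm, so the Euclidean norm that
   enters the Hausdorff metric is spelled out. *)
Definition enorm (x : 'rV[R]_n) : R := Num.sqrt (\sum_i x 0 i ^+ 2).

Definition hausdorff_dist A B : R :=
  inf [set e | [/\ 0 <= e,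
     forall x, A x -> exists2 y, B y & enorm (x - y) <= e &
     forall y, B y -> exists2 x, A x & enorm (x - y) <= e]].

End Geometry.

(* n-dimensional Lebesgue measure, as the n-fold product of the Lebesgue
   measure on the line. *)
Fixpoint lebesgue_tuple (R : realType) (n : nat) :
    set (n.-tuple (measurableTypeR R)) -> \bar R :=
  match n with
  | 0 => \d_ [tuple]
  | m.+1 => pushforward (@lebesgue_measure R \x @lebesgue_tuple R m)%E
              (fun z => [tuple of z.1 :: z.2])
  end.

Section Functionals.
Context {R : realType} {n : nat}.
Implicit Types A : set 'rV[R]_n.

Definition volume A : R :=
  fine (@lebesgue_tuple R n [set t | A (\row_i tnth t i)]).

Definition euler_char A : R := if `[< A !=set0 >] then 1 else 0.

End Functionals.

Record polytope0 (R : realType) (n : nat) := Polytope0 {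
  polytope0_set :> set 'rV[R]_n;
  polytope0P : is_polytope polytope0_set;
  polytope0_0 : polytope0_set 0 }.

HB.instance Definition _ (R : realType) (n : nat) := gen_eqMixin (polytope0 R n).
HB.instance Definition _ (R : realType) (n : nat) :=
  gen_choiceMixin (polytope0 R n).

Lemma polytope0_inj (R : realType) (n : nat) :
  injective (@polytope0_set R n).
Proof.
case=> A pA A0 [B pB B0] /= AB; case: B / AB pB B0 => pB B0.
by congr Polytope0; exact: Prop_irrelevance.
Qed.

Section EuclideanNorm.
Context {R : realType} {n : nat}.
Implicit Types x y : 'rV[R]_n.

Lemma enorm_ge0 x : 0 <= enorm x.
Proof. exact: sqrtr_ge0. Qed.

Lemma enorm0 : enorm (0 : 'rV[R]_n) = 0.
Proof. by rewrite /enorm big1 ?sqrtr0// => i _; rewrite mxE expr0n. Qed.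

Lemma enormN x : enorm (- x) = enorm x.
Proof. by congr Num.sqrt; apply: eq_bigr => i _; rewrite mxE sqrrN. Qed.

Lemma enormC x y : enorm (x - y) = enorm (y - x).
Proof. by rewrite -enormN opprB. Qed.

Lemma sqr_enorm x : enorm x ^+ 2 = \sum_i x 0 i ^+ 2.
Proof. by rewrite sqr_sqrtr// sumr_ge0// => i _; exact: sqr_ge0. Qed.

Lemma coord_le_enorm x i : `|x 0 i| <= enorm x.
Proof.
rewrite -(@ler_pXn2r _ 2)// ?nnegrE ?enorm_ge0// sqr_enorm real_normK ?num_real//.
by rewrite (bigD1 i)//= lerDl sumr_ge0// => j _; exact: sqr_ge0.
Qed.

Lemma enorm_eq0 x : enorm x = 0 -> x = 0.
Proof.
move=> x0; apply/rowP => i; apply/eqP; rewrite mxE -normr_le0 -x0.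
exact: coord_le_enorm.
Qed.

Lemma cauchy_schwarz x y : \sum_i x 0 i * y 0 i <= enorm x * enorm y.
Proof.
have [/eqP|x0] := eqVneq (enorm x) 0.
  by move=> /eqP /enorm_eq0 ->; rewrite big1 ?enorm0 ?mul0r// => i _; rewrite mxE mul0r.
have [/eqP|y0] := eqVneq (enorm y) 0.
  by move=> /eqP /enorm_eq0 ->; rewrite big1 ?enorm0 ?mulr0// => i _; rewrite mxE mulr0.
set a := enorm x; set b := enorm y.
have a0 : 0 < a by rewrite lt_def x0 enorm_ge0.
have b0 : 0 < b by rewrite lt_def y0 enorm_ge0.
have ab0 : 0 < 2 * (a * b) by rewrite !mulr_gt0.
rewrite -(ler_pM2l ab0) -subr_ge0.
have -> : 2 * (a * b) * (a * b) - 2 * (a * b) * (\sum_i x 0 i * y 0 i) =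
    \sum_i (b * x 0 i - a * y 0 i) ^+ 2.
  transitivity (b ^+ 2 * (\sum_i x 0 i ^+ 2) + a ^+ 2 * (\sum_i y 0 i ^+ 2) -
      2 * (a * b) * (\sum_i x 0 i * y 0 i)).
    by rewrite -!sqr_enorm -/a -/b; ring.
  rewrite !mulr_sumr -big_split/= -sumrB.
  by apply: eq_bigr => i _; ring.
by apply: sumr_ge0 => i _; exact: sqr_ge0.
Qed.

Lemma enormD x y : enorm (x + y) <= enorm x + enorm y.
Proof.
rewrite -(@ler_pXn2r _ 2)// ?nnegrE ?addr_ge0 ?enorm_ge0//.
have -> : enorm (x + y) ^+ 2 =
    enorm x ^+ 2 + (\sum_i x 0 i * y 0 i) *+ 2 + enorm y ^+ 2.
  rewrite !sqr_enorm -sumrMnl -!big_split/=.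
  by apply: eq_bigr => i _; rewrite mxE sqrrD.
by rewrite sqrrD lerD2r lerD2l lerMn2r cauchy_schwarz.
Qed.

Lemma enormB_trans y x z : enorm (x - z) <= enorm (x - y) + enorm (y - z).
Proof. by apply: le_trans (enormD _ _); rewrite addrA subrK. Qed.

Lemma enormZ (a : R) x : enorm (a *: x) = `|a| * enorm x.
Proof.
rewrite /enorm; under eq_bigr => i _ do rewrite mxE exprMn.
by rewrite -mulr_sumr sqrtrM ?sqr_ge0// sqrtr_sqr.
Qed.

End EuclideanNorm.

Section PolytopeTheory.
Context {R : realType}.

Lemma convex_hull_image (V W : lmodType R) (f : {linear V -> W}) (S : set V) :
  f @` convex_hull S = convex_hull (f @` S).
Proof.
apply/seteqP; split => [_ [_ [k [a [x [a0 a1 xS ->]]]] <-]|p].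
  exists k, a, (f \o x); split => //; first by move=> i; exists (x i).
  by rewrite linear_sum; apply: eq_bigr => i _; rewrite linearZ.
move=> [k [a [y [a0 a1 yS ->]]]].
have yS' i : exists v, S v /\ f v = y i by have [v Sv fv] := yS i; exists v.
have [x xP] := choice yS'.
exists (\sum_i a i *: x i).
  by exists k, a, x; split => // i; have [] := xP i.
rewrite linear_sum; apply: eq_bigr => i _; rewrite linearZ.
by have [_ ->] := xP i.
Qed.

Definition simplex m : set 'rV[R]_m :=
  [set b | (forall i, 0 <= b 0 i) /\ \sum_i b 0 i = 1].

Lemma convex_hull_simplex (V : lmodType R) (s : seq V) :
  convex_hull [set` s] =
  [set \sum_i b 0 i *: tnth (in_tuple s) i | b in @simplex (size s)].
Proof.
apply/seteqP; split => [p [k [a [x [a0 a1 xS ->]]]]|_ [b [b0 b1] <-]]; last first.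
  exists (size s), (b 0), (tnth (in_tuple s)); split => // i.
  exact: mem_tnth.
have xP i : exists j, x i = tnth (in_tuple s) j by apply/tnthP; exact: xS.
have [h hP] := choice xP.
exists (\row_j \sum_(i | h i == j) a i).
  split=> [j|]; first by rewrite mxE sumr_ge0.
  rewrite -a1 (partition_big h predT)//=.
  by apply: eq_bigr => j _; rewrite mxE.
rewrite [RHS](partition_big h predT)//=.
apply: eq_bigr => j _; rewrite mxE scaler_suml.
by apply: eq_bigr => i /eqP <-; rewrite -hP.
Qed.

Lemma rV_sum_continuous m n (v : 'I_m -> 'rV[R]_n) :
  continuous (fun b : 'rV[R]_m => \sum_i b 0 i *: v i).
Proof.
move=> b; have FF := nbhs_filter b; apply: cvg_big => [|i _]; first exact: add_continuous.
by apply: cvgZr_tmp; exact: coord_continuous.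
Qed.

Lemma rV_coord_sum_continuous m :
  continuous (fun b : 'rV[R]_m => \sum_i b 0 i).
Proof.
move=> b; have FF := nbhs_filter b; apply: cvg_big => [|i _]; first exact: add_continuous.
exact: coord_continuous.
Qed.

Lemma simplex_compact m : compact (@simplex m).
Proof.
have cube : compact [set b : 'rV[R]_m | forall i, b ord0 i \in `[(0 : R), 1]].
  by apply: (@rV_compact R m (fun=> `[(0 : R), 1]%classic)) => i; exact: segment_compact.
apply: subclosed_compact cube _ => [|b [b0 b1] i]; last first.
  rewrite /= in_itv/= b0/= -b1 (bigD1 i)//= lerDl.
  by apply: sumr_ge0 => j _; exact: b0.
have -> : @simplex m = (\bigcap_i [set b : 'rV[R]_m | 0 <= b 0 i]) `&`
    (fun b : 'rV[R]_m => \sum_i b 0 i) @^-1` [set 1].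
  by apply/seteqP; split => b [b0 b1]; split => // i; [move=> _; exact: b0 | exact: b0].
apply: closedI; last first.
  apply: closed_comp => [b _|]; first exact: rV_coord_sum_continuous.
  exact/accessible_closed_set1/hausdorff_accessible/Rhausdorff.
apply: closed_bigI => i _.
apply: (@closed_comp _ _ (fun b : 'rV[R]_m => b 0 i) [set x | 0 <= x]).
  by move=> b _; exact: coord_continuous.
exact: closed_ge.
Qed.

Lemma polytope_compact n (P : set 'rV[R]_n) : is_polytope P -> compact P.
Proof.
move=> [S /finite_seqP[s ->] ->]; rewrite convex_hull_simplex.
apply: continuous_compact (@simplex_compact _).
exact/continuous_subspaceT/rV_sum_continuous.
Qed.

Lemma polytope_closed n (P : set 'rV[R]_n) : is_polytope P -> closed P.
Proof. by move=> /polytope_compact; apply: compact_closed; exact: norm_hausdorff. Qed.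

Lemma polytope_bounded n (P : set 'rV[R]_n) : is_polytope P ->
  exists M : R, forall x, P x -> enorm x <= M.
Proof.
move=> [S /finite_seqP[s ->] ->]; rewrite convex_hull_simplex.
exists (\sum_i enorm (tnth (in_tuple s) i)) => _ [b [b0 b1] <-].
apply: (@le_trans _ _ (\sum_i enorm (b 0 i *: tnth (in_tuple s) i))).
  elim/big_ind2 : _ => //; first by rewrite enorm0.
  by move=> x a y c xa yc; apply: le_trans (enormD _ _) _; exact: lerD.
apply: ler_sum => i _; rewrite enormZ ger0_norm//.
rewrite ler_piMl ?enorm_ge0// -b1 (bigD1 i)//= lerDl.
by apply: sumr_ge0 => j _; exact: b0.
Qed.

End PolytopeTheory.

Section HausdorffMetric.
Context {R : realType} {n : nat}.
Implicit Types P Q : polytope0 R n.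

Let dist P Q : R := hausdorff_dist P Q.

Let adm P Q := [set e : R | [/\ 0 <= e,
  forall x, (P : set _) x -> exists2 y, (Q : set _) y & enorm (x - y) <= e &
  forall y, (Q : set _) y -> exists2 x, (P : set _) x & enorm (x - y) <= e]].

Let adm_has_inf P Q : has_inf (adm P Q).
Proof.
split; last by exists 0 => e [].
have [M MP] := polytope_bounded (polytope0P P).
have [N NQ] := polytope_bounded (polytope0P Q).
have M0 : 0 <= M by rewrite -(@enorm0 R n); apply: MP; exact: polytope0_0.
have N0 : 0 <= N by rewrite -(@enorm0 R n); apply: NQ; exact: polytope0_0.
exists (M + N); split; first exact: addr_ge0.
- move=> x Px; exists 0; first exact: polytope0_0.
  by rewrite subr0; apply: le_trans (MP _ Px) _; rewrite lerDl.
- move=> y Qy; exists 0; first exact: polytope0_0.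
  by rewrite sub0r enormN; apply: le_trans (NQ _ Qy) _; rewrite lerDr.
Qed.

Let dist_le P Q e : adm P Q e -> dist P Q <= e.
Proof. by move=> Pe; apply: ge_inf Pe; have [] := adm_has_inf P Q. Qed.

Let dist_adm P Q e : dist P Q < e -> adm P Q e.
Proof.
move=> de; have e0 : 0 < e - dist P Q by rewrite subr_gt0.
have [d [d0 d1 d2]] := inf_adherent e0 (adm_has_inf P Q).
rewrite -/(dist P Q) addrC subrK => /ltW lde; split; first exact: le_trans lde.
- by move=> x /d1[y Qy xy]; exists y => //; exact: le_trans lde.
- by move=> y /d2[x Px xy]; exists x => //; exact: le_trans lde.
Qed.

Let dist_ge0 P Q : 0 <= dist P Q.
Proof. by apply: lb_le_inf => [|e []//]; have [] := adm_has_inf P Q. Qed.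

Lemma hausdorff_distxx P : dist P P = 0.
Proof.
apply/eqP; rewrite eq_le dist_ge0 andbT; apply: dist_le.
by split => // x Px; exists x; rewrite ?subrr ?enorm0.
Qed.

Lemma hausdorff_dist_sym P Q : dist P Q = dist Q P.
Proof.
suff H P' Q' : dist P' Q' <= dist Q' P' by apply/eqP; rewrite eq_le !H.
apply/ler_addgt0Pl => e e0; apply: dist_le.
have : dist Q' P' < e + dist Q' P' by rewrite ltrDr.
move=> /dist_adm[d0 d1 d2]; split => // x.
- by move=> /d2[y Py xy]; exists y => //; rewrite enormC.
- by move=> /d1[y Py xy]; exists y => //; rewrite enormC.
Qed.

Lemma hausdorff_dist_triangle Q P T : dist P T <= dist P Q + dist Q T.
Proof.
apply/ler_addgt0Pr => e e0.
have e20 : 0 < e / 2 by rewrite divr_gt0.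
have /dist_adm[a0 a1 a2] : dist P Q < dist P Q + e / 2 by rewrite ltrDl.
have /dist_adm[b0 b1 b2] : dist Q T < dist Q T + e / 2 by rewrite ltrDl.
apply: dist_le; rewrite [e]splitr addrACA; split; first exact: addr_ge0.
- move=> x /a1[y /b1[z Tz yz] xy]; exists z => //.
  by apply: le_trans (enormB_trans y _ _) _; exact: lerD.
- move=> z /b2[y /a2[x Px xy] yz]; exists x => //.
  by apply: le_trans (enormB_trans y _ _) _; exact: lerD.
Qed.

Let dist0_sub P Q : dist P Q = 0 -> (P : set _) `<=` Q.
Proof.
move=> d0 x Px; apply: (polytope_closed (polytope0P Q)).
rewrite closureEnbhs => A B AQ /nbhs_ballP[e /= e0 eB].
have : dist P Q < e / 2 by rewrite d0 divr_gt0.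
move=> /dist_adm[_ /(_ _ Px)[y Qy xy] _]; exists y; split; first exact: AQ.
apply: eB; split => // i j; rewrite ord1 /ball/=.
have := coord_le_enorm (x - y) j; rewrite !mxE => /le_lt_trans; apply.
by apply: le_lt_trans xy _; rewrite ltr_pdivrMr// ltr_pMr// ltr1n.
Qed.

Lemma hausdorff_dist_eq0 P Q : dist P Q = 0 -> P = Q.
Proof.
move=> d0; apply: polytope0_inj; apply/seteqP; split; apply: dist0_sub => //.
by rewrite hausdorff_dist_sym.
Qed.

HB.instance Definition _ := isMetric.Build R (polytope0 R n)
  hausdorff_distxx hausdorff_dist_eq0 hausdorff_dist_sym hausdorff_dist_triangle.

End HausdorffMetric.

Section Action.
Context {R : realType} {n : nat}.

(* A acts on column vectors, hence as x |-> x *m A^T on row vectors. *)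
Definition lin_image (A : 'M[R]_n) (P : set 'rV[R]_n) : set 'rV[R]_n :=
  [set x *m A^T | x in P].

Lemma lin_image_polytope A P : is_polytope P -> is_polytope (lin_image A P).
Proof.
move=> [S finS ->]; exists ((mulmxr A^T) @` S); first exact: finite_image.
by rewrite -convex_hull_image.
Qed.

Lemma lin_image0 A (P : set 'rV[R]_n) : P 0 -> lin_image A P 0.
Proof. by move=> P0; exists 0 => //; rewrite mul0mx. Qed.

Definition polytope0_image (A : 'M[R]_n) (P : polytope0 R n) : polytope0 R n :=
  Polytope0 (lin_image_polytope A (polytope0P P)) (lin_image0 A (polytope0_0 P)).

Implicit Type Psi : polytope0 R n -> R.

Definition borel_measurable Psi :=
  forall U : set R, open U -> <<s @open (polytope0 R n) >> (Psi @^-1` U).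

Definition sl_invariant Psi :=
  forall A : 'M[R]_n, \det A = 1 -> forall P, Psi (polytope0_image A P) = Psi P.

Definition valuation Psi :=
  forall P Q PuQ PnQ : polytope0 R n,
    PuQ = P `|` Q :> set _ -> PnQ = P `&` Q :> set _ ->
    Psi P + Psi Q = Psi PuQ + Psi PnQ.

End Action.

(* Main.v *)
(* Subtracting the right-hand side reduces the classification to two facts.
   First, a valuation on polytopes containing the origin that vanishes on all
   simplices with a vertex at the origin vanishes: cutting by hyperplanes through
   the origin reduces any such polytope to pieces of the form
   {l <= 1} /\ (polyhedral cone), and then peels off the generators of the cone
   one at a time until the cone is simplicial. Second, SL(n) acts transitively on
   the k-dimensional simplices with a vertex at the origin when k < n, and with
   the volume as only invariant when k = n; cutting such a simplex through an
   edge opposite to the origin shows that the value is the same constant for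
   0 < k < n, and differs from it by an additive function of the volume for
   k = n. A measurable additive function is linear.

   Conversely, (-1)^dim P 1_{relint P}(0) only depends on the cone spanned by P;
   it is (-1)^dim when this cone is a subspace and 0 otherwise, and the valuation
   property is a discussion of two cones whose union is convex. The volume is
   SL(n) invariant by Fubini applied to shears, and measurable because it is upper
   semicontinuous. *)
Require Import Defs.
From HB Require Import structures.
From mathcomp Require Import all_boot all_order all_algebra.
From mathcomp Require Import all_classical all_reals all_analysis.
From mathcomp Require Import perm measurable_realfun ring lra.

Import Order.TTheory GRing.Theory Num.Theory.
Import numFieldNormedType.Exports.

Local Open Scope classical_set_scope.
Local Open Scope ring_scope.

Set Implicit Arguments.
Unset Strict Implicit.
Unset Printing Implicit Defensive.

(** * Polytopes and simplices with a vertex at the origin *)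

(** Both pieces of a cut must contain the origin, so only hyperplanes through 0 are available;
    facets away from 0 are handled by comparing their functionals with each other, not by cutting
    along them. The three constants reflect three kinds of test simplices: {0}, those of dimension
    strictly between 0 and n, and the full-dimensional ones. The functional (-1)^dim P 1_{relint
    P}(0) is 1 on {0} and 0 on every other simplex with a vertex at 0, so it separates {0} from
    segments, which neither V_0 nor V_n can do. The assumption n >= 2 provides a segment of
    dimension less than n, whose value is c_0; it also ensures that the common face of the two parts
    of a cut full-dimensional simplex has positive dimension, hence this same value. The constant
    c_n is obtained as a ratio of two slopes, so the volume of a simplex only has to be shown
    positive. *)

Section Corner.
Context {R : realType} {n : nat}.
Implicit Types (x y : 'rV[R]_n).

(** The convex hull of 0 and the [v i]: the slack in the inequality is the weight of 0. A general
    finite index type allows [I + I * I] for the vertices of a cut. *)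
Definition fcorner (I : finType) (v : I -> 'rV[R]_n) : set 'rV[R]_n :=
  [set x | exists a : I -> R,
    [/\ forall i, 0 <= a i, \sum_i a i <= 1 & x = \sum_i a i *: v i]].

Definition corner k (M : 'M[R]_(k, n)) := fcorner (fun i : 'I_k => row i M).

Lemma cornerP k (M : 'M[R]_(k, n)) x : corner M x <->
  exists a : 'rV_k, [/\ forall i, 0 <= a 0 i, \sum_i a 0 i <= 1 & x = a *m M].
Proof.
split=> [[a [a0 a1 ->]]|[a [a0 a1 ->]]].
  exists (\row_i a i); split=> [i||]; first by rewrite mxE.
    by under eq_bigr do rewrite mxE.
  by rewrite mulmx_sum_row; under [RHS]eq_bigr do rewrite mxE.
by exists (a 0); split; rewrite // mulmx_sum_row.
Qed.

Lemma fcorner0 (I : finType) (v : I -> 'rV[R]_n) : fcorner v 0.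
Proof.
exists (fun=> 0); split => //; first by rewrite big1.
by rewrite big1// => i _; rewrite scale0r.
Qed.

Lemma fcorner_sum (I : finType) (v : I -> 'rV[R]_n) (J : finType) (a : J -> R)
    (x : J -> 'rV[R]_n) : (forall j, 0 <= a j) -> \sum_j a j <= 1 ->
  (forall j, fcorner v (x j)) -> fcorner v (\sum_j a j *: x j).
Proof.
move=> a0 a1 /choice[c cP].
exists (fun i => \sum_j a j * c j i); split.
- by move=> i; apply: sumr_ge0 => j _; rewrite mulr_ge0//; have [->] := cP j.
- rewrite exchange_big/=; apply: le_trans a1; apply: ler_sum => j _.
  by rewrite -mulr_sumr ler_piMr//; have [] := cP j.
- rewrite (eq_bigr (fun j => \sum_i (a j * c j i) *: v i)) => [|j _].
    by rewrite exchange_big/=; apply: eq_bigr => i _; rewrite scaler_suml.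
  have [_ _ ->] := cP j; rewrite scaler_sumr.
  by apply: eq_bigr => i _; rewrite scalerA.
Qed.

Lemma fcorner_convex (I : finType) (v : I -> 'rV[R]_n) x y a b :
  0 <= a -> 0 <= b -> a + b <= 1 -> fcorner v x -> fcorner v y ->
  fcorner v (a *: x + b *: y).
Proof.
move=> a0 b0 ab vx vy.
have := @fcorner_sum I v bool (fun i => if i then a else b) (fun i => if i then x else y).
rewrite !big_bool/=; apply => //; by case.
Qed.

Lemma fcorner_vertex (I : finType) (v : I -> 'rV[R]_n) i : fcorner v (v i).
Proof.
exists (fun j => (j == i)%:R); split=> [j||]; first by rewrite ler0n.
  by rewrite (bigD1 i)//= eqxx big1 ?addr0// => j /negPf ->.
by rewrite (bigD1 i)//= eqxx scale1r big1 ?addr0// => j /negPf ->; rewrite scale0r.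
Qed.

Lemma fcorner_polytope (I : finType) (v : I -> 'rV[R]_n) : is_polytope (fcorner v).
Proof.
exists ([set 0] `|` range v); first by rewrite finite_setU; split => //; exact: finite_image.
apply/seteqP; split=> [_ [a [a0 a1 ->]]|_ [k [a [x [a0 a1 xS ->]]]]].
  pose c (i : 'I_(#|I|.+1)) : R :=
    oapp (fun j => a (enum_val j)) (1 - \sum_i a i) (unlift ord0 i).
  pose w (i : 'I_(#|I|.+1)) := oapp (fun j => v (enum_val j)) 0 (unlift ord0 i).
  have c0E : c ord0 = 1 - \sum_i a i by rewrite /c unlift_none.
  have w0E : w ord0 = 0 by rewrite /w unlift_none.
  have cE i : c (lift ord0 i) = a (enum_val i) by rewrite /c liftK.
  have wE i : w (lift ord0 i) = v (enum_val i) by rewrite /w liftK.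
  exists _, c, w; split=> [i|||].
  - by rewrite /c; case: unliftP => [j|] _ /=; rewrite ?subr_ge0.
  - rewrite big_ord_recl c0E (eq_bigr _ (fun i _ => cE i)).
    by rewrite -big_enum_val subrK.
  - move=> i; rewrite /w; case: unliftP => [j|] _ /=; [right|left] => //.
    by exists (enum_val j).
  - rewrite big_ord_recl w0E scaler0 add0r.
    under [RHS]eq_bigr do rewrite cE wE.
    by rewrite -(@big_enum_val _ _ _ _ _ (fun i => a i *: v i)).
apply: fcorner_sum => //; first by rewrite a1.
by move=> j; have [->|[i _ <-]] := xS j; [exact: fcorner0|exact: fcorner_vertex].
Qed.

Lemma polytope_corner (P : set 'rV[R]_n) : is_polytope P -> P 0 ->
  exists k (M : 'M[R]_(k, n)), P = corner M.
Proof.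
move=> [S /finite_seqP[s ->] ->]; rewrite convex_hull_simplex => -[b0 [b00 b01] b0E].
exists (size s), (\matrix_i tnth (in_tuple s) i).
apply/seteqP; split=> [_ [b [b0' b1] <-]|_ [a [a0 a1 ->]]].
  by exists (b 0); split; rewrite ?b1//; apply: eq_bigr => i _; rewrite rowK.
(* The slack is spread along the representation [b0] of 0, which completes the sum to 1 without
   moving the point. *)
exists (\row_i (a i + (1 - \sum_i a i) * b0 0 i)).
  split=> [i|]; first by rewrite mxE addr_ge0// mulr_ge0// subr_ge0.
  under eq_bigr do rewrite mxE.
  by rewrite big_split/= -mulr_sumr b01 mulr1 addrC subrK.
under eq_bigr do rewrite mxE scalerDl -scalerA.
rewrite big_split/= -scaler_sumr b0E scaler0 addr0.
by apply: eq_bigr => i _; rewrite rowK.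
Qed.

Lemma polytope0_corner (P : polytope0 R n) : exists k (M : 'M[R]_(k, n)), P = corner M :> set _.
Proof. by apply: polytope_corner; [exact: polytope0P|exact: polytope0_0]. Qed.

Definition fcorner_poly (I : finType) (v : I -> 'rV[R]_n) : polytope0 R n :=
  Polytope0 (fcorner_polytope v) (fcorner0 v).

Definition corner_poly k (M : 'M[R]_(k, n)) : polytope0 R n := fcorner_poly (fun i : 'I_k => row i M).

Lemma polytope0_convex (P : polytope0 R n) x y a b :
  0 <= a -> 0 <= b -> a + b <= 1 -> (P : set _) x -> (P : set _) y -> (P : set _) (a *: x + b *: y).
Proof. by have [k [M ->]] := polytope0_corner P; exact: fcorner_convex. Qed.

Lemma polytope0_star (P : polytope0 R n) x a :
  0 <= a <= 1 -> (P : set _) x -> (P : set _) (a *: x).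
Proof.
move=> /andP[a0 a1] Px.
have := @polytope0_convex P x x a 0 a0 (lexx _) _ Px Px.
by rewrite scale0r !addr0; apply.
Qed.

(** The multiple of a nonzero [v] of norm [K + 1] leaves the ball of radius [K] containing [P]. *)
Lemma polytope0_norecession (P : polytope0 R n) v :
  (forall t, 0 <= t -> (P : set _) (t *: v)) -> v = 0.
Proof.
move=> Pv; apply/enorm_eq0/eqP; rewrite eq_le enorm_ge0 andbT leNgt; apply/negP => v0.
have [K PK] := polytope_bounded (polytope0P P).
have K0 : 0 <= K by rewrite -(@enorm0 R n); apply: PK; exact: polytope0_0.
have := PK _ (Pv ((K + 1) / enorm v) _).
rewrite enormZ ger0_norm ?divr_ge0 ?addr_ge0 ?enorm_ge0// divfK ?gt_eqF//.
by rewrite gerDl ler10 => /(_ isT).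
Qed.

End Corner.

(** * Cuts by halfspaces through the origin *)

Section Halfspaces.
Context {R : realType} {n : nat}.
Implicit Types (x y q : 'rV[R]_n) (h : 'cV[R]_n) (hs : seq 'cV[R]_n).

Definition dot x h : R := (x *m h) 0 0.

Lemma dotDl x y h : dot (x + y) h = dot x h + dot y h.
Proof. by rewrite /dot mulmxDl mxE. Qed.
Lemma dotZl a x h : dot (a *: x) h = a * dot x h.
Proof. by rewrite /dot -scalemxAl mxE. Qed.
Lemma dotNl x h : dot (- x) h = - dot x h.
Proof. by rewrite /dot mulNmx mxE. Qed.
Lemma dot0l h : dot 0 h = 0.
Proof. by rewrite /dot mul0mx mxE. Qed.
Lemma dotDr x g h : dot x (g + h) = dot x g + dot x h.
Proof. by rewrite /dot mulmxDr mxE. Qed.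
Lemma dotZr a x h : dot x (a *: h) = a * dot x h.
Proof. by rewrite /dot -scalemxAr mxE. Qed.
Lemma dotNr x h : dot x (- h) = - dot x h.
Proof. by rewrite /dot mulmxN mxE. Qed.
Lemma dot_suml (I : finType) (a : I -> R) (v : I -> 'rV[R]_n) h :
  dot (\sum_i a i *: v i) h = \sum_i a i * dot (v i) h.
Proof.
rewrite /dot mulmx_suml summxE; apply: eq_bigr => i _.
by rewrite -scalemxAl mxE.
Qed.

Definition dotE := (dotDl, dotZl, dotNl, dot0l, dotDr, dotZr, dotNr).

(* Each segment from a vertex in {h < 0} to a vertex in {h > 0} meets {h = 0}
   in one point; these points and the vertices in {h <= 0} span the cut. *)
Lemma fcorner_halfspace (I : finType) (v : I -> 'rV[R]_n) h :
  is_polytope (fcorner v `&` [set x | dot x h <= 0]).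
Proof.
pose hv i := dot (v i) h.
(* Indices that describe no vertex of the cut get the harmless value 0. *)
pose w (z : I + I * I) := match z with
  | inl i => if hv i <= 0 then v i else 0
  | inr (i, j) => if (hv i < 0) && (0 < hv j) then
       (hv j - hv i)^-1 *: (hv j *: v i - hv i *: v j) else 0
  end.
suff -> : fcorner v `&` [set x | dot x h <= 0] = fcorner w by exact: fcorner_polytope.
apply/seteqP; split=> [_ [[a [a0 a1 ->]] /=]|_ [c [c0 c1 ->]]]; last first.
  split.
    apply: fcorner_sum => // -[i|[i j]] /=; case: ifPn => [|_]; try exact: fcorner0.
      by move=> _; exact: fcorner_vertex.
    move=> /andP[hi hj].
    have hij : 0 < hv j - hv i by lra.
    rewrite scalerBr -scaleNr !scalerA addrC.
    apply: fcorner_convex; try exact: fcorner_vertex.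
    - by rewrite mulNr -mulrN mulr_ge0 ?invr_ge0//; lra.
    - by rewrite mulr_ge0 ?invr_ge0//; lra.
    - by rewrite mulNr addrC -mulrBr mulVf ?gt_eqF.
  move=> /=; rewrite dot_suml; apply: sumr_le0 => -[i|[i j]] _ /=; rewrite mulr_ge0_le0//.
    by case: ifPn => //; rewrite dot0l.
  case: ifPn; rewrite ?dot0l// => /andP[hi hj].
  by rewrite !dotE -!/(hv _) (mulrC (hv j)) subrr mulr0.
rewrite dot_suml => ah0.
pose p i := if 0 < hv i then a i else 0.
pose q i := if hv i < 0 then a i else 0.
pose z i := if hv i == 0 then a i else 0.
have apqz i : a i = p i + q i + z i.
  by rewrite /p /q /z; case: ltgtP => _; rewrite ?addr0 ?add0r.
have p0 i : 0 <= p i by rewrite /p; case: ifP.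
have q0 i : 0 <= q i by rewrite /q; case: ifP.
have z0 i : 0 <= z i by rewrite /z; case: ifP.
(* The moments of the weights above and below the plane; the point lies in the halfspace exactly
   when [A <= B]. *)
pose A := \sum_i p i * hv i; pose B := - \sum_i q i * hv i.
have pA i : 0 <= p i * hv i.
  by rewrite /p; case: ifP => hi; rewrite ?mul0r// mulr_ge0// ltW.
have qB i : 0 <= - (q i * hv i).
  by rewrite /q; case: ifP => hi; rewrite ?mul0r ?oppr0// -mulrN mulr_ge0// oppr_ge0 ltW.
have A0 : 0 <= A by exact: sumr_ge0.
have B0 : 0 <= B by rewrite /B -sumrN; exact: sumr_ge0.
have AB : A <= B.
  rewrite -subr_le0 /B opprK -big_split/=; apply: le_trans ah0.
  apply: ler_sum => i _; rewrite -mulrDl /p /q -/(hv i).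
  by case: ltgtP => [hi|hi|<-]; rewrite ?addr0 ?add0r ?mulr0 ?mul0r.
(* Each vertex below the plane keeps the share [1 - A / B] of its weight and spends the rest on
   pairs with the vertices above; [hv j - hv i] cancels the normalization in [w]. *)
pose c (s : I + I * I) := match s with
  | inl i => z i + q i * (1 - A / B)
  | inr (i, j) => q i * p j * (hv j - hv i) / B
  end.
have AB1 : A / B <= 1.
  have [->|B_neq0] := eqVneq B 0; first by rewrite invr0 mulr0.
  by rewrite ler_pdivrMr ?mul1r// lt_def B_neq0.
(* When [B = 0] the quotients by [B] are 0 by convention, which is right because there is then no
   weight above the plane to distribute. *)
have pB0 : B = 0 -> forall i, p i = 0.
  move=> B_eq0 i; have A_eq0 : A = 0 by apply/eqP; rewrite eq_le A0 -B_eq0 AB.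
  have := A_eq0; rewrite /A => /eqP; rewrite psumr_eq0// => /allP /(_ i).
  rewrite mem_index_enum => /(_ isT) /implyP /(_ isT).
  by rewrite /p; case: ifP => // hi; rewrite mulf_eq0 (gt_eqF hi) orbF => /eqP.
(* The same identity is used for the points [v i] and for the weights. *)
have key (V : lmodType R) (g : I -> V) :
    \sum_i (z i + q i * (1 - A / B)) *: g i +
    \sum_ij (q ij.1 * p ij.2 / B) *: (hv ij.2 *: g ij.1 - hv ij.1 *: g ij.2) =
    \sum_i a i *: g i.
  have -> : \sum_ij (q ij.1 * p ij.2 / B) *: (hv ij.2 *: g ij.1 - hv ij.1 *: g ij.2) =
      \sum_i (A / B * q i + B / B * p i) *: g i.
    rewrite -(pair_bigA _ (fun i j => (q i * p j / B) *: (hv j *: g i - hv i *: g j)))/=.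
    under eq_bigr => i _ do (under eq_bigr do rewrite scalerBr !scalerA -scaleNr; rewrite big_split/=).
    rewrite big_split/= [X in _ + X]exchange_big/= -big_split/=; apply: eq_bigr => i _.
    rewrite -!scaler_suml -scalerDl; congr (_ *: _); congr (_ + _).
      by rewrite /A !mulr_suml; apply: eq_bigr => j _; ring.
    by rewrite /B -sumrN !mulr_suml; apply: eq_bigr => j _; ring.
  rewrite -big_split/=; apply: eq_bigr => i _; rewrite -scalerDl; congr (_ *: _).
  rewrite [a i]apqz; have [B_eq0|B_neq0] := eqVneq B 0.
    by rewrite B_eq0 pB0// invr0; ring.
  by rewrite divff//; ring.
have csum (V : lmodType R) (g : I -> V) (f : I + I * I -> V) :
    (forall i, hv i <= 0 -> f (inl i) = g i) ->
    (forall i j, hv i < 0 -> 0 < hv j ->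
      f (inr (i, j)) = (hv j - hv i)^-1 *: (hv j *: g i - hv i *: g j)) ->
    \sum_s c s *: f s = \sum_i a i *: g i.
  move=> f1 f2; rewrite big_sumType/= -key; congr (_ + _).
    apply: eq_bigr => i _; have [hi|hi] := leP (hv i) 0; first by rewrite f1.
    have -> : z i = 0 by rewrite /z gt_eqF.
    have -> : q i = 0 by rewrite /q ltNge ltW.
    by rewrite mul0r addr0 !scale0r.
  apply: eq_bigr => -[i j] _ /=.
  have [qp|] := eqVneq (q i * p j) 0; first by rewrite qp !mul0r !scale0r.
  rewrite /q /p; case: ifP => hi; last by rewrite mul0r eqxx.
  case: ifP => hj; last by rewrite mulr0 eqxx.
  move=> _; rewrite f2// scalerA; congr (_ *: _).
  have hij : hv j - hv i != 0 by rewrite gt_eqF//; lra.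
  by rewrite mulrAC mulfK.
exists c; split.
- move=> [i|[i j]] /=; first by rewrite addr_ge0// mulr_ge0// subr_ge0.
  rewrite mulr_ge0 ?invr_ge0// /q /p.
  case: ifP => hi; last by rewrite !mul0r.
  case: ifP => hj; last by rewrite mulr0 mul0r.
  by rewrite !mulr_ge0//; lra.
- have := csum R^o (fun=> 1) (fun=> 1); rewrite /GRing.scale/= => cE.
  rewrite (_ : \sum_i c i = \sum_i a i)//.
  transitivity (\sum_i c i * 1); first by apply: eq_bigr => i _; rewrite mulr1.
  rewrite cE => [|//|i j hi hj]; first by apply: eq_bigr => i _; rewrite mulr1.
  by rewrite !mulr1 mulVf// gt_eqF//; lra.
- rewrite -(csum _ v w)// => [i hi|i j hi hj] /=; first by rewrite hi.
  by rewrite hi hj.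
Qed.

Lemma polytope0_halfspace (P : polytope0 R n) h :
  is_polytope ((P : set _) `&` [set x | dot x h <= 0]).
Proof. by have [k [M ->]] := polytope0_corner P; exact: fcorner_halfspace. Qed.

End Halfspaces.

(** * Polyhedral cones and elimination *)

Section PolyhedralCones.
Context {R : realType} {n : nat}.
Implicit Types (x y q : 'rV[R]_n) (h : 'cV[R]_n) (hs : seq 'cV[R]_n).

Definition pcone hs : set 'rV[R]_n := [set x | forall h, h \in hs -> dot x h <= 0].

Lemma pcone_cons h hs : pcone (h :: hs) = [set x | dot x h <= 0] `&` pcone hs.
Proof.
apply/seteqP; split=> x.
  move=> xhs; split; first by apply: xhs; rewrite mem_head.
  by move=> g ghs; apply: xhs; rewrite in_cons ghs orbT.
by move=> [xh xhs] g; rewrite in_cons => /orP[/eqP ->//|]; exact: xhs.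
Qed.

Lemma pcone_cat hs gs : pcone (hs ++ gs) = pcone hs `&` pcone gs.
Proof.
elim: hs => [|h hs ih] /=; last by rewrite !pcone_cons ih setIA.
by rewrite (_ : pcone [::] = setT) ?setTI//; apply/seteqP; split.
Qed.

(* Fourier-Motzkin elimination of the parameter [t]. *)
Lemma pcone_ray hs q :
  exists hs', [set x | exists2 t, 0 <= t & pcone hs (x - t *: q)] = pcone hs'.
Proof.
exists ([seq h <- hs | dot q h <= 0] ++
  [seq dot q p.1 *: p.2 - dot q p.2 *: p.1 |
    p <- [seq (g, h) | g <- [seq g <- hs | 0 < dot q g], h <- [seq h <- hs | dot q h < 0]]]).
rewrite pcone_cat; apply/seteqP; split=> [x [t t0 xt]|x [x1 x2]].
  have xh h : h \in hs -> dot x h <= t * dot q h.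
    by move=> /xt; rewrite !dotE subr_le0.
  split=> [h|h'].
    rewrite mem_filter => /andP[qh /xh] /le_trans; apply.
    exact: mulr_ge0_le0.
  move=> /mapP[[g h] /allpairsP[[g' h'']/= []]].
  rewrite !mem_filter => /andP[qg ghs] /andP[qh hhs] [-> ->] ->.
  rewrite !dotE subr_le0.
  have := xh _ ghs; have := xh _ hhs => xh1 xg1.
  have : dot q g' * dot x h'' <= dot q g' * (t * dot q h'') by rewrite ler_wpM2l// ltW.
  have : dot q h'' * (t * dot q g') <= dot q h'' * dot x g' by rewrite ler_nM2l.
  lra.
(* The smallest admissible parameter: the maximum of 0 and all lower bounds imposed by constraints
   that are positive on [q]. *)
pose t := \big[Num.max/0]_(g <- hs | 0 < dot q g) (dot x g / dot q g).
have t0 : 0 <= t by rewrite /t; elim/big_rec : _ => // g y _ y0; rewrite le_max y0 orbT.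
exists t => // h hhs; rewrite !dotE subr_le0.
have [qh|qh|qh] := ltgtP (dot q h) 0.
- rewrite -ler_ndivlMr//.
  rewrite /t big_seq_cond; elim/big_ind : _ => [|a b a0 b0|g /andP[ghs qg]].
  + rewrite ler_ndivlMr// mul0r; apply: x1.
    by rewrite mem_filter ltW.
  + by rewrite ge_max a0.
  + rewrite ler_pdivrMr// mulrAC ler_ndivlMr// mulrC [leRHS]mulrC -subr_le0 -!dotZr -dotNr -dotDr.
    apply: x2; apply/mapP; exists (g, h) => //.
    by apply/allpairsP; exists (g, h); rewrite !mem_filter qg qh.
- rewrite -ler_pdivrMr// /t.
  exact: (@bigmax_sup_seq _ _ _ _ _ h).
- rewrite qh mulr0; apply: x1; by rewrite mem_filter qh lexx.
Qed.

End PolyhedralCones.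

(** * From vertices to inequalities *)

Section HRepresentation.
Context {R : realType}.

(** One half of the Minkowski-Weyl theorem: each new generator is eliminated by [pcone_ray],
    starting from {0}, which the coordinates and their opposites cut out. *)
Lemma finitely_generated_cone n k (q : 'I_k -> 'rV[R]_n) : exists hs : seq 'cV[R]_n,
  [set x | exists2 a : 'I_k -> R, forall i, 0 <= a i & x = \sum_i a i *: q i] = pcone hs.
Proof.
elim: k q => [|k ih] q.
  exists ([seq delta_mx i 0 | i <- enum 'I_n] ++ [seq - delta_mx i 0 | i <- enum 'I_n]).
  rewrite pcone_cat; apply/seteqP; split=> [_ [a _ ->]|x [x1 x2]].
    by rewrite big_ord0; split=> h _; rewrite dot0l.
  exists (fun=> 0) => //; rewrite big_ord0; apply/rowP => i; rewrite mxE.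
  have dE : dot x (delta_mx i 0) = x 0 i.
    by rewrite /dot -colE mxE.
  have h1 : dot x (delta_mx i 0) <= 0 by apply: x1; apply: map_f; rewrite mem_enum.
  have : dot x (- delta_mx i 0) <= 0 by apply: x2; apply: map_f; rewrite mem_enum.
  by rewrite dotNr oppr_le0 => h2; apply/eqP; rewrite -dE eq_le h1.
have [hs hsE] := ih (fun i => q (lift ord0 i)).
have [hs' hs'E] := pcone_ray hs (q ord0).
exists hs'; rewrite -hs'E -hsE; apply/seteqP; split=> [_ [a a0 ->]|x [t t0 [a a0 xE]]].
  exists (a ord0) => //; exists (fun i => a (lift ord0 i)) => //.
  by rewrite big_ord_recl addrAC subrr add0r.
exists (fun i => oapp a t (unlift ord0 i)) => [i|].
  by case: unliftP => [j|] _ /=.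
rewrite big_ord_recl unlift_none/= (eq_bigr (fun i => a i *: q (lift ord0 i))) => [|i _].
  by rewrite -xE addrC subrK.
by rewrite liftK.
Qed.

(** Homogenization: the vertices are lifted to height 1 in one more dimension, and [P] is the slice
    at height 1 of the cone they generate. *)
Lemma polytope0_halfspaces n (P : polytope0 R n) : exists ls ms : seq 'cV[R]_n,
  P = [set x | (forall l, l \in ls -> dot x l <= 1) /\ pcone ms x] :> set _.
Proof.
have [k [M PE]] := polytope0_corner P.
pose q (i : 'I_k.+1) : 'rV[R]_(n + 1) :=
  oapp (fun i => row_mx (row i M) 1%:M) (row_mx 0 1%:M) (unlift ord0 i).
have [hs hsE] := finitely_generated_cone q.
have qS (i : 'I_k) : q (lift ord0 i) = row_mx (row i M) 1%:M by rewrite /q liftK.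
have q0 : q ord0 = row_mx 0 1%:M by rewrite /q unlift_none.
have qsum (a : 'I_k -> R) : \sum_i a i *: q (lift ord0 i) =
    row_mx (\sum_i a i *: row i M) (\sum_i a i)%:M.
  rewrite -[LHS]hsubmxK !linear_sum/=; congr row_mx.
    by apply: eq_bigr => i _; rewrite linearZ/= qS row_mxKl.
  rewrite raddf_sum/=; apply: eq_bigr => i _.
  by rewrite linearZ/= qS row_mxKr scale_scalar_mx mulr1.
have {hsE} PE' x : (P : set _) x <-> pcone hs (row_mx x 1%:M).
  rewrite PE -hsE; split=> [[a [a0 a1 ->]]|[a a0]].
    exists (fun i => oapp a (1 - \sum_i a i) (unlift ord0 i)) => [i|].
      by case: unliftP => //= _; rewrite subr_ge0.
    rewrite big_ord_recl unlift_none/= q0 (eq_bigr (fun i => a i *: q (lift ord0 i))).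
      by rewrite qsum scale_row_mx scaler0 add_row_mx add0r scale_scalar_mx mulr1 -raddfD/= subrK.
    by move=> i _; rewrite liftK.
  rewrite big_ord_recl q0 qsum scale_row_mx scaler0 add_row_mx add0r.
  rewrite scale_scalar_mx mulr1 -raddfD/= => /eq_row_mx[-> /(congr1 (fun A : 'M[R]_1 => A 0 0))].
  rewrite !mxE eqxx !mulr1n => a1; exists (fun i => a (lift ord0 i)); split => //.
  by rewrite a1 lerDr.
pose d (h : 'cV[R]_(n + 1)) : R := dsubmx h 0 0.
have dotE' (x : 'rV[R]_n) h : dot (row_mx x 1%:M) h = dot x (usubmx h) + d h.
  by rewrite /dot -{1}[h]vsubmxK mul_row_col mul1mx mxE.
(* Evaluation at the origin fixes the sign of the constant term: a negative one can be scaled to the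
   form [l <= 1], a zero one gives a conical constraint. *)
have d0 h : h \in hs -> d h <= 0.
  have /PE'/[apply] := polytope0_0 P.
  by rewrite dotE' dot0l add0r.
exists [seq (- d h)^-1 *: usubmx h | h <- hs & d h < 0].
exists [seq usubmx h | h <- hs & d h == 0].
apply/seteqP; split=> x.
  move=> /PE' xh; split=> l /mapP[h]; rewrite mem_filter => /andP[dh hhs] ->.
    rewrite dotZr mulrC ler_pdivrMr ?oppr_gt0// mul1r -subr_ge0 -opprD oppr_ge0.
    by rewrite addrC -dotE'; exact: xh.
  by have := xh _ hhs; rewrite dotE' (eqP dh) addr0.
move=> [x1 x2]; apply/PE' => h hhs; rewrite dotE'.
have := d0 _ hhs; rewrite le_eqVlt => /orP[dh|dh].
  rewrite (eqP dh) addr0; apply: x2; apply/mapP; exists h => //.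
  by rewrite mem_filter dh.
have := x1 ((- d h)^-1 *: usubmx h).
rewrite dotZr mulrC ler_pdivrMr ?oppr_gt0// mul1r -subr_ge0 -opprD oppr_ge0 addrC; apply.
by apply/mapP; exists h => //; rewrite mem_filter dh.
Qed.

End HRepresentation.

(** * Valuations vanishing on simplices *)

Section Vanishing.
Context {R : realType} {n : nat}.
Variable Phi : polytope0 R n -> R.
Hypothesis Phi_val : valuation Phi.
Implicit Types (A : set 'rV[R]_n) (h : 'cV[R]_n) (hs gs ms : seq 'cV[R]_n).

(** Vacuous unless [A] is a polytope containing 0, so cuts can be iterated on plain sets without
    carrying proofs that the pieces are polytopes. *)
Definition null A := forall P : polytope0 R n, P = A :> set _ -> Phi P = 0.

Lemma null_cut A h : null (A `&` pcone [:: h]) -> null (A `&` pcone [:: - h]) ->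
  null (A `&` pcone [:: h; - h]) -> null A.
Proof.
have pcone1 g : pcone [:: g] = [set x | dot x g <= 0].
  by rewrite pcone_cons (_ : pcone [::] = setT) ?setIT//; apply/seteqP.
have cutP (P : polytope0 R n) g : exists Q : polytope0 R n, Q = (P : set _) `&` pcone [:: g] :> set _.
  have Q0 : ((P : set _) `&` pcone [:: g]) 0.
    by split=> [|h' _]; [exact: polytope0_0|rewrite dot0l].
  have := polytope0_halfspace P g; rewrite -pcone1 => Qp.
  by exists (Polytope0 Qp Q0).
move=> n1 n2 n12 P PA.
have [P1 P1E] := cutP P h; have [P2 P2E] := cutP P (- h).
have [P12 P12E] := cutP P1 (- h).
have := @Phi_val P1 P2 P P12; rewrite (n1 P1) ?P1E ?PA// (n2 P2) ?P2E ?PA//.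
rewrite (n12 P12) ?P12E ?P1E ?PA//; last by rewrite -setIA -pcone_cat.
rewrite !addr0 => ->//.
  rewrite -setIUr (_ : _ `|` _ = setT) ?setIT//; apply/seteqP; split=> // x _.
  rewrite !pcone1 /= dotNr oppr_le0.
  by have [] := leP (dot x h) 0; [left|move=> /ltW; right].
by rewrite setIACA setIid setIA.
Qed.

(** Iterated [null_cut]: [gs] records the chosen sides, with both signs for the pieces inside a
    hyperplane, so every functional of [hs] has constant sign on each piece. *)
Lemma null_cuts hs A :
  (forall gs, (forall g, g \in gs -> g \in hs \/ - g \in hs) ->
    (forall h, h \in hs -> (forall x, A x -> pcone gs x -> dot x h <= 0) \/
                           (forall x, A x -> pcone gs x -> 0 <= dot x h)) ->
    null (A `&` pcone gs)) -> null A.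
Proof.
elim: hs A => [|h hs ih] A Ags.
  have := Ags [::]; rewrite (_ : pcone [::] = setT) ?setIT//; last by apply/seteqP.
  by apply.
have sub gs0 : (forall g, g \in gs0 -> g \in h :: hs \/ - g \in h :: hs) ->
    ((forall x, pcone gs0 x -> dot x h <= 0) \/ (forall x, pcone gs0 x -> 0 <= dot x h)) ->
    null (A `&` pcone gs0).
  move=> gs0h hsign; apply: ih => gs gsh gssign; rewrite -setIA -pcone_cat; apply: Ags.
    move=> g; rewrite mem_cat => /orP[/gs0h//|/gsh[]]; rewrite !in_cons => ->; rewrite orbT; by [left|right].
  move=> h'; rewrite in_cons => /orP[/eqP ->|].
    by case: hsign => hsign; [left|right] => x Ax; rewrite pcone_cat => -[/hsign].
  move=> /gssign[] hh; [left|right] => x Ax; rewrite pcone_cat => -[x1 x2]; exact: hh.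
apply: (@null_cut _ h); apply: sub.
- by move=> g; rewrite !inE => /eqP ->; left; rewrite eqxx.
- by left=> x; apply; rewrite inE.
- by move=> g; rewrite !inE => /eqP ->; right; rewrite opprK eqxx.
- by right=> x /(_ (- h)); rewrite inE eqxx dotNr oppr_le0; apply.
- by move=> g; rewrite !inE => /orP[] /eqP ->; [left|right]; rewrite ?opprK eqxx.
- by left=> x; apply; rewrite !inE eqxx.
Qed.

Hypothesis Phi_simplex : forall k (M : 'M[R]_(k, n)), row_free M -> Phi (corner_poly M) = 0.

Lemma row_dual j (M : 'M[R]_(j, n)) (U : 'M[R]_(n, j)) i k :
  M *m U = 1%:M -> (row i M *m U) 0 k = (i == k)%:R.
Proof. by move=> MU; rewrite -row_mul MU !mxE. Qed.

Lemma row_dot0 j (M : 'M[R]_(j, n)) (m : 'cV[R]_n) i : M *m m = 0 -> dot (row i M) m = 0.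
Proof. by move=> Mm; rewrite /dot -row_mul Mm !mxE. Qed.

(** The columns of [U] are coordinates dual to the vertex directions already split off, [ms]
    constrains the complementary directions, and [l] is the only facet functional left away from
    0. *)
Definition join_set j (U : 'M[R]_(n, j)) ms l : set 'rV[R]_n :=
  [set x | [/\ forall i, 0 <= (x *m U) 0 i, pcone ms x & dot x l <= 1]].

Lemma null_simplex j (M : 'M[R]_(j, n)) (U : 'M[R]_(n, j)) ms l :
  M *m U = 1%:M -> (forall m, m \in ms -> M *m m = 0) ->
  (forall p, p *m U = 0 -> pcone ms p -> p = 0) -> null (join_set U ms l).
Proof.
move=> MU Mms nop P PE.
(* Otherwise the whole ray through [row i M] would lie in the bounded set [P]. *)
have lpos i : 0 < dot (row i M) l.
  rewrite ltNge; apply/negP => li.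
  suff r0 : row i M = 0.
    by have := row_dual i i MU; rewrite r0 mul0mx mxE eqxx => /eqP; rewrite eq_sym oner_eq0.
  apply: (@polytope0_norecession _ _ P) => t t0; rewrite PE; split.
  - by move=> k; rewrite -scalemxAl mxE row_dual// mulr_ge0.
  - by move=> m /Mms Mm; rewrite dotZl row_dot0// mulr0.
  - by rewrite dotZl; apply: le_trans ler01; exact: mulr_ge0_le0.
pose N := \matrix_i ((dot (row i M) l)^-1 *: row i M).
have rowN i : row i N = (dot (row i M) l)^-1 *: row i M by rewrite rowK.
suff PN : P = corner_poly N.
  rewrite PN; apply: Phi_simplex; apply/row_freeP.
  exists (U *m diag_mx (\row_i dot (row i M) l)).
  apply/matrixP => i k; rewrite mulmxA mul_mx_diag [LHS]mxE [RHS]mxE [X in _ * X]mxE.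
  have -> : (N *m U) i k = (row i N *m U) 0 k by rewrite -row_mul [RHS]mxE.
  rewrite rowN -scalemxAl mxE row_dual//.
  by have [->|_] := eqVneq i k; rewrite ?mulr1 ?mulr0 ?mul0r// mulVf// gt_eqF.
apply: polytope0_inj; rewrite PE; apply/seteqP; split=> [x [xU xms xl]|_ [a [a0 a1 ->]]].
  (* The difference of the two sides lies in the remaining cone, which is trivial. *)
  have xE : x = (x *m U) *m M.
    apply/eqP; rewrite -subr_eq0; apply/eqP/nop.
      by rewrite mulmxBl -!mulmxA MU mulmx1 subrr.
    move=> m mms; rewrite dotDl dotNl /dot -!mulmxA Mms// !mulmx0 [X in _ - X]mxE subr0.
    exact: xms.
  exists (fun i => (x *m U) 0 i * dot (row i M) l); split.
  - by move=> i; rewrite mulr_ge0// ltW.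
  - rewrite -dot_suml.
    by rewrite -mulmx_sum_row -xE.
  - rewrite {1}xE mulmx_sum_row; apply: eq_bigr => i _.
    by rewrite rowN scalerA mulfK// gt_eqF.
split.
- move=> k; rewrite mulmx_suml summxE; apply: sumr_ge0 => i _.
  by rewrite rowN scalerA -scalemxAl mxE row_dual// !mulr_ge0// invr_ge0 ltW.
- move=> m /Mms Mm; rewrite dot_suml big1// => i _.
  by rewrite rowN dotZl (row_dot0 _ Mm) !mulr0.
- rewrite dot_suml; apply: le_trans a1; apply: ler_sum => i _.
  by rewrite rowN dotZl mulVf ?mulr1// gt_eqF.
Qed.

(** On a piece produced by [null_cuts] any two functionals compare in the same way at all points, so
    a single one is minimal everywhere. *)
Lemma uniform_min (T : eqType) (X : Type) (f : T -> X -> R) (B : set X) (s : seq T) a :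
  a \in s ->
  (forall a b, a \in s -> b \in s ->
    (forall x, B x -> f a x <= f b x) \/ (forall x, B x -> f b x <= f a x)) ->
  exists2 m, m \in s & forall a x, a \in s -> B x -> f m x <= f a x.
Proof.
elim: s a => // b s ih a _ tot.
have [s0|] := eqVneq s [::].
  by exists b; rewrite ?mem_head// s0 => c x; rewrite inE => /eqP ->.
case: s => // c s in ih tot * => _.
have [||m ms mP] := ih c; first by rewrite mem_head.
  by move=> a' b' a's b's; apply: tot; rewrite in_cons ?a's ?b's orbT.
have mbs : m \in b :: c :: s by rewrite in_cons ms orbT.
have [bm|mb] := tot b m (mem_head _ _) mbs.
  exists b; first by rewrite mem_head.
  move=> a' x; rewrite in_cons => /orP[/eqP ->//|a's] Bx.
  exact: le_trans (bm _ Bx) (mP _ _ a's Bx).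
exists m; first by rewrite in_cons ms orbT.
by move=> a' x; rewrite in_cons => /orP[/eqP -> Bx|a's Bx]; [exact: mb|exact: mP].
Qed.

(* The remaining constraints [ms] only involve the directions complementary to
   the rows of [M], which are already vertices; a point [p] of the remaining cone
   is split off by cutting along the functionals that decide through which facet
   a point leaves the cone when moving in direction [- p]. *)
Lemma null_join d j (M : 'M[R]_(j, n)) (U : 'M[R]_(n, j)) ms l :
  (n < j + d)%N -> M *m U = 1%:M -> (forall m, m \in ms -> M *m m = 0) ->
  null (join_set U ms l).
Proof.
elim: d j M U ms l => [|d ih] j M U ms l njd MU Mms.
  (* The counter [d] cannot run out: more than [n] rows have no right inverse. *)
  by rewrite addn0 in njd; have := mulmx1_min MU; rewrite leqNgt njd.
have [[p [p_neq0 pU pms]]|nop] := pselect (exists p, [/\ p != 0, p *m U = 0 & pcone ms p]); last first.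
  by apply: (null_simplex MU Mms) => p pU pms; apply/eqP; apply: contra_notT nop => p0; exists p.
move=> P0 P0E.
(* If all constraints vanished at [p], both [p] and [- p] would satisfy them, and the one on which
   [l] is nonpositive would span a ray inside a bounded set. *)
have [m0 m0ms pm0] : exists2 m, m \in ms & dot p m < 0.
  apply: contrapT => nom.
  have pm m : m \in ms -> dot p m = 0.
    move=> mms; apply/eqP; rewrite eq_le pms// leNgt; apply/negP => pm.
    by apply: nom; exists m.
  have sP s : dot (s *: p) l <= 0 -> s *: p = 0.
    move=> spl; apply: (@polytope0_norecession _ _ P0) => t t0; rewrite P0E; split.
    - by move=> i; rewrite -!scalemxAl pU !scaler0 mxE.
    - by move=> m /pm mp; rewrite !dotZl mp !mulr0.
    - by rewrite dotZl; apply: le_trans ler01; exact: mulr_ge0_le0.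
  have [pl|pl] := leP (dot p l) 0.
    by have := sP 1; rewrite scale1r => /(_ pl)/eqP; rewrite (negPf p_neq0).
  have := sP (- 1); rewrite scaleN1r dotNl oppr_le0 => /(_ (ltW pl))/eqP.
  by rewrite oppr_eq0 (negPf p_neq0).
apply: (_ : null (join_set U ms l)) => // {P0 P0E}.
(* Moving from [x] in direction [- p], the constraint [m] holds up to time [dot x (t m)]. *)
pose t m : 'cV[R]_n := (dot p m)^-1 *: m.
pose ts := [seq t m | m <- ms & dot p m < 0].
have tsP a : a \in ts -> exists2 m, m \in ms & dot p m < 0 /\ a = t m.
  by move=> /mapP[m]; rewrite mem_filter => /andP[pm mms] ->; exists m.
have tsI m : m \in ms -> dot p m < 0 -> t m \in ts.
  by move=> mms pm; apply: map_f; rewrite mem_filter pm.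
have pts a : a \in ts -> dot p a = 1.
  by move=> /tsP[m _ [pm ->]]; rewrite dotZr mulVf// lt_eqF.
have Mts a : a \in ts -> M *m a = 0.
  by move=> /tsP[m mms [pm ->]]; rewrite -scalemxAr Mms// scaler0.
apply: (@null_cuts [seq a - b | a <- ts, b <- ts]) => gs gsh gss.
(* One exit time [u] is the earliest throughout the piece; it becomes the coordinate dual to the new
   vertex direction [p]. *)
have [u uts umin] : exists2 u, u \in ts & forall a x, a \in ts ->
    (join_set U ms l `&` pcone gs) x -> dot x u <= dot x a.
  apply: (@uniform_min _ _ (fun a x => dot x a) _ _ (t m0)); first exact: tsI.
  move=> a b ats bts; have [|ab|ab] := gss (a - b).
  - by apply/allpairsP; exists (a, b).
  - by left=> x [xJ xg]; rewrite -subr_le0 -dotNr -dotDr ab.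
  - by right=> x [xJ xg]; rewrite -subr_ge0 -dotNr -dotDr ab.
have [m' m'ms [pm' uE]] := tsP _ uts.
have gsE g : g \in gs -> dot p g = 0 /\ M *m g = 0.
  have h0 h : h \in [seq a - b | a <- ts, b <- ts] -> dot p h = 0 /\ M *m h = 0.
    move=> /allpairsP[[a b]/= [ats bts ->]].
    by rewrite dotDr dotNr !pts// subrr mulmxBr !Mts// subrr.
  move=> /gsh[/h0//|/h0]; rewrite dotNr mulmxN => -[/eqP + /eqP].
  by rewrite !oppr_eq0 => /eqP -> /eqP ->.
(* The constraints negative at [p] are dropped, since they follow from [0 <= dot x u] and
   [dot x u <= dot x (t m)]; all those that remain vanish at [p] and on the rows of [M]. *)
have := @ih (1 + j)%N (col_mx p M) (row_mx u U)
  ([seq m <- ms | dot p m == 0] ++ [seq u - a | a <- ts] ++ gs) l.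
have p1 h : p *m h = (dot p h)%:M by rewrite [LHS]mx11_scalar.
rewrite (_ : join_set _ _ _ = join_set U ms l `&` pcone gs).
  apply.
  - by rewrite add1n addSnnS.
  - by rewrite mul_col_row pU MU Mts// p1 pts// -scalar_mx_block.
  - move=> m; rewrite !mem_cat mem_filter mul_col_mx p1 => /orP[/andP[/eqP -> mms]|/orP[/mapP[a ats ->]|/gsE[-> ->]]].
    + by rewrite Mms// raddf0 col_mx0.
    + by rewrite dotDr dotNr !pts// subrr mulmxBr !Mts// subrr raddf0 col_mx0.
    + by rewrite raddf0 col_mx0.
apply/seteqP; split=> x.
  rewrite /join_set !pcone_cat => -[xU [xm [xu xg]] xl].
  have xu0 : 0 <= dot x u.
    by have := xU (lshift j 0); rewrite mul_mx_row row_mxEl.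
  split=> //; split=> // [i|m mms].
    by have := xU (rshift 1 i); rewrite mul_mx_row row_mxEr.
  have := pms _ mms; rewrite le_eqVlt => /orP[pm|pm].
    by apply: xm; rewrite mem_filter pm.
  have := xu (u - t m); rewrite dotDr dotNr dotZr subr_le0 => /(_ (map_f _ (tsI _ mms pm))).
  by move=> /(le_trans xu0); rewrite mulrC ler_ndivlMr// mul0r.
move=> xJg; have [[xU xm xl] xg] := xJg.
have xu0 : 0 <= dot x u.
  by have := xm _ m'ms => xm'; rewrite uE dotZr mulr_le0// invr_le0 ltW.
split => //; last rewrite !pcone_cat; last split.
- move=> i; rewrite mul_mx_row; case: (split_ordP i) => k ->.
    by rewrite row_mxEl ord1.
  by rewrite row_mxEr.
- by move=> m; rewrite mem_filter => /andP[_]; exact: xm.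
- split=> // h /mapP[a ats ->]; rewrite dotDr dotNr subr_le0; exact: umin.
Qed.

Theorem valuation_simplices_eq0 (P : polytope0 R n) : Phi P = 0.
Proof.
have [ls0 [ms PE]] := polytope0_halfspaces P.
(* The trivial constraint 0 <= 1 makes the list nonempty, so that a largest functional exists. *)
pose ls := 0 :: ls0.
have {}PE : P = [set x | (forall l, l \in ls -> dot x l <= 1) /\ pcone ms x] :> set _.
  rewrite PE; apply/seteqP; split=> x [x1 x2]; split=> // l.
    by rewrite in_cons => /orP[/eqP ->|]; [rewrite /dot mulmx0 mxE|exact: x1].
  by move=> lls; apply: x1; rewrite in_cons lls orbT.
suff : null P by apply.
apply: (@null_cuts [seq a - b | a <- ls, b <- ls]) => gs gsh gss.
(* On each piece one functional dominates, and [l <= 1] then implies the other facet inequalities;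
   opposites turn the maximum into a minimum. *)
have [l lls lmax] : exists2 l, l \in ls & forall a x, a \in ls ->
    ((P : set _) `&` pcone gs) x -> - dot x l <= - dot x a.
  apply: (@uniform_min _ _ (fun a x => - dot x a) _ _ 0); first exact: mem_head.
  move=> a b als bls; have [|ab|ab] := gss (a - b).
  - by apply/allpairsP; exists (a, b).
  - by right=> x [xJ xg]; rewrite lerN2 -subr_le0 -dotNr -dotDr ab.
  - by left=> x [xJ xg]; rewrite lerN2 -subr_ge0 -dotNr -dotDr ab.
have := @null_join n.+1 0 0 0 ([seq a - l | a <- ls] ++ ms ++ gs) l.
rewrite (_ : join_set _ _ _ = (P : set _) `&` pcone gs).
  by apply => //; [apply/matrixP => -[]|move=> m _; exact: mul0mx].
rewrite /join_set !pcone_cat; apply/seteqP; split=> x.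
  move=> [_ [xa [xm xg]] xl]; split => //; rewrite PE; split=> // a als.
  apply: le_trans xl; rewrite -subr_le0 -dotNr -dotDr; apply: xa.
  exact: (map_f (fun a => a - l)).
move=> xPg; have := xPg.1; rewrite PE => -[x1 x2]; split.
- by case.
- split; [|split=> //; exact: xPg.2].
  by move=> h /mapP[a als ->]; rewrite dotDr dotNr subr_le0 -lerN2; exact: lmax.
- exact: x1.
Qed.

End Vanishing.

(** * Volume *)

Section TupleMeasure.
Context {R : realType}.
Notation mR := (measurableTypeR R).

Lemma measure_sigma_finite d (T : measurableType d) (nu : {measure set T -> \bar R}) :
  sigma_finite setT nu ->
  exists mu : {sigma_finite_measure set T -> \bar R}, mu = nu :> (set _ -> \bar R).
Proof.
move=> nusf.
pose nu' : {sigma_finite_measure set T -> \bar R} :=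
  HB.pack_for (SigmaFiniteMeasure.type T R) (Measure.sort nu)
    (isSFinite.Build _ _ _ _ (sfinite_measure_sigma_finite nusf))
    (isSigmaFinite.Build _ _ _ _ nusf).
by exists nu'.
Qed.

Let tcons n (z : mR * n.-tuple mR) : n.+1.-tuple mR := [tuple of z.1 :: z.2].

Let measurable_tcons n : measurable_fun setT (@tcons n).
Proof. exact: measurable_cons. Qed.

(** [lebesgue_tuple] is a bare set function; sigma-finiteness is what the product with one more line
    and Fubini require. It is carried along the pushforward by products of exhausting sets. *)
Lemma sigma_finite_lebesgue_tuple n :
  exists mu : {sigma_finite_measure set (n.-tuple mR) -> \bar R},
    @lebesgue_tuple R n = mu :> (set _ -> \bar R).
Proof.
elim: n => [|n [mu muE]].
  by exists (\d_ ([tuple] : 0.-tuple mR)).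
pose pr : {measure set (mR * n.-tuple mR)%type -> \bar R} := (@lebesgue_measure R \x mu)%E.
pose nu : {measure set (n.+1.-tuple mR) -> \bar R} :=
  measure_function_pushforward__canonical__measure_function_Measure pr (@measurable_tcons n).
have nusf : sigma_finite setT nu.
  have /sigma_finiteP[F [FT Fnd Ffin]] := sigma_finiteT (@lebesgue_measure R).
  have /sigma_finiteP[G [GT Gnd Gfin]] := sigma_finiteT mu.
  exists (fun k => [set t : n.+1.-tuple mR | F k (thead t) /\ G k [tuple of behead t]]).
    apply/seteqP; split=> // t _.
    have [i _ Fi] : (\bigcup_k F k) (thead t) by rewrite -FT.
    have [j _ Gj] : (\bigcup_k G k) [tuple of behead t] by rewrite -GT.
    exists (maxn i j) => //; split.
    - by move: Fi; apply/subsetPset/Fnd/leq_maxl.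
    - by move: Gj; apply/subsetPset/Gnd/leq_maxr.
  move=> k; have [mF Foo] := Ffin k; have [mG Goo] := Gfin k; split.
    apply: measurableI.
      by rewrite -[X in measurable X]setTI; apply: (@measurable_tnth _ _ n.+1 ord0).
    by rewrite -[X in measurable X]setTI; apply: (@measurable_behead _ _ n).
  rewrite /nu/= /pushforward (_ : _ @^-1` _ = F k `*` G k).
    by rewrite product_measure1E// lte_mul_pinfty// ge0_fin_numE.
  apply/seteqP; split=> -[x t] /=; rewrite theadE.
    by rewrite (_ : [tuple of _] = t)//; exact: val_inj.
  by rewrite (_ : [tuple of _] = t)//; exact: val_inj.
by have [nu' nu'E] := measure_sigma_finite nusf; exists nu'; rewrite nu'E /= muE.
Qed.

Definition tuple_measure n : {sigma_finite_measure set (n.-tuple mR) -> \bar R} :=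
  sval (cid (sigma_finite_lebesgue_tuple n)).

Lemma tuple_measureE n : @lebesgue_tuple R n = tuple_measure n :> (set _ -> \bar R).
Proof. by rewrite /tuple_measure; case: cid. Qed.

End TupleMeasure.

Section Volume.
Context {R : realType}.
Notation mR := (measurableTypeR R).
Notation mu n := (@tuple_measure R n).

Definition rowt n (t : n.-tuple mR) : 'rV[R]_n := \row_i tnth t i.

(* The product sigma-algebra lives on tuples, so measurability of a set of row
   vectors is expressed through [rowt]. *)
Definition rmeas n (X : set 'rV[R]_n) := measurable (@rowt n @^-1` X).

Definition vol n (X : set 'rV[R]_n) : \bar R := mu n (@rowt n @^-1` X).

Lemma volumeE n (X : set 'rV[R]_n) : volume X = fine (vol X).
Proof. by rewrite /volume tuple_measureE. Qed.

Lemma measurable_preimage_row d (T : measurableType d) n (f : T -> 'rV[R]_n) (X : set 'rV[R]_n) :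
  (forall i, measurable_fun setT (fun t => f t 0 i : mR)) -> rmeas X -> measurable (f @^-1` X).
Proof.
move=> mf mX.
rewrite (_ : f @^-1` X = (fun t => [tuple f t 0 i | i < n] : n.-tuple mR) @^-1` (@rowt n @^-1` X)).
  rewrite -[X in measurable X]setTI.
  suff mg : measurable_fun setT (fun t => [tuple f t 0 i | i < n] : n.-tuple mR) by exact: mg.
  apply/measurable_fun_tnthP => i; rewrite (_ : _ \o _ = fun t => f t 0 i)//.
  by apply/funext => t /=; rewrite tnth_mktuple.
apply/seteqP; split=> t /=; rewrite (_ : rowt _ = f t)//; apply/rowP => i; by rewrite mxE tnth_mktuple.
Qed.

Lemma measurable_coord n (i : 'I_n) : measurable_fun setT (fun t : n.-tuple mR => rowt t 0 i : mR).
Proof.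
by under eq_fun do rewrite mxE; exact: measurable_tnth.
Qed.

Lemma measurable_mulmx n m (B : 'M[R]_(n, m)) i :
  measurable_fun setT (fun t : n.-tuple mR => (rowt t *m B) 0 i : mR).
Proof.
under eq_fun do rewrite mxE.
apply: (@measurable_sum _ _ _ _ _ _ (fun j (t : n.-tuple mR) => rowt t 0 j * B j i)) => j.
by apply: measurable_funM => //; exact: measurable_coord.
Qed.

Lemma rowt_cons n x (t : n.-tuple mR) : rowt [tuple of x :: t] = row_mx x%:M (rowt t) :> 'rV_(1 + n).
Proof.
apply/rowP => i; rewrite mxE; case: (@split_ordP 1 n i) => j ->.
  rewrite row_mxEl !mxE ord1 eqxx mulr1n (_ : lshift n 0 = ord0)//.
  exact: val_inj.
by rewrite row_mxEr mxE (_ : rshift 1 j = lift ord0 j) ?tnthS//; exact: val_inj.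
Qed.

Lemma vol_slice n (X : set 'rV[R]_(1 + n)) :
  vol X = (\int[@lebesgue_measure R]_x vol [set v | X (row_mx x%:M v)])%E.
Proof.
rewrite /vol -tuple_measureE /= /pushforward /product_measure1.
apply: eq_integral => x _ /=; rewrite tuple_measureE; congr (mu n _).
by apply/seteqP; split=> t; rewrite /xsection/= inE/= -rowt_cons.
Qed.

(** The order of integration opposite to that of [vol_slice]; it rests on the uniqueness of the
    product measure. *)
Lemma vol_fubini n (X : set 'rV[R]_(1 + n)) : rmeas X ->
  vol X = (\int[mu n]_t (@lebesgue_measure R) [set x | X (row_mx x%:M (rowt t))])%E.
Proof.
move=> mX; rewrite /vol -tuple_measureE /= /pushforward tuple_measureE.
pose Y := (fun z : mR * n.-tuple mR => row_mx z.1%:M (rowt z.2) : 'rV[R]_(1 + n)) @^-1` X.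
have mY : measurable Y.
  apply: (measurable_preimage_row _ mX) => i; case: (@split_ordP 1 n i) => j ->.
    by under eq_fun do rewrite row_mxEl mxE ord1 eqxx mulr1n; exact: measurable_fst.
  under eq_fun do rewrite row_mxEr; apply: (measurableT_comp (@measurable_coord _ _)) => //.
rewrite (_ : _ @^-1` _ = Y); last first.
  by apply/seteqP; split=> -[x t]; rewrite /Y /= rowt_cons.
transitivity ((@lebesgue_measure R \x^ mu n)%E Y).
  by apply: product_measure_unique => //= A B mA mB; rewrite product_measure2E.
rewrite /product_measure2; apply: eq_integral => t _ /=; congr (lebesgue_measure _).
by apply/seteqP; split=> x; rewrite /ysection/= inE.
Qed.

(** The translated measure agrees with Lebesgue measure on half-open intervals, which determine
    it. *)
Lemma lebesgue_measure_translate (A : set mR) c : measurable A ->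
  @lebesgue_measure R [set x | A (x + c)] = lebesgue_measure A.
Proof.
move=> mA.
have mf : measurable_fun setT (fun x : mR => x + c : mR).
  by apply: measurable_funD.
pose nu := measure_function_pushforward__canonical__measure_function_Measure
  (@lebesgue_measure R) mf.
rewrite -[LHS]/(nu A); apply/esym/lebesgue_measure_unique => // _ [[a b] _ <-].
rewrite /nu /= /pushforward.
rewrite (_ : _ @^-1` _ = `]a - c, b - c]%classic).
  rewrite !lebesgue_measure_itv/= !lte_fin ltrD2r; case: ifP => // _.
  by rewrite -!EFinB; congr (_%:E); ring.
by apply/seteqP; split=> x /=; rewrite !in_itv/= ltrBlDr lerBrDr.
Qed.

(** Preimages compose, and measurability passes to them without inverting the map. *)
Definition vpres n (f : 'rV[R]_n -> 'rV[R]_n) :=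
  forall X, rmeas X -> rmeas (f @^-1` X) /\ vol (f @^-1` X) = vol X.

Lemma vpres_comp n (f g : 'rV[R]_n -> 'rV[R]_n) : vpres f -> vpres g -> vpres (f \o g).
Proof.
move=> pf pg X mX; have [mfX vfX] := pf _ mX; have [mgX vgX] := pg _ mfX.
by split; rewrite comp_preimage// vgX.
Qed.

Lemma vpres_ext n (f g : 'rV[R]_n -> 'rV[R]_n) : f =1 g -> vpres f -> vpres g.
Proof. by move=> /funext ->. Qed.

Lemma rmeas_slice n (X : set 'rV[R]_(1 + n)) x : rmeas X -> rmeas [set v | X (row_mx x%:M v)].
Proof.
move=> mX; apply: (measurable_preimage_row _ mX) => i; case: (@split_ordP 1 n i) => j ->.
  by under eq_fun do rewrite row_mxEl; exact: measurable_cst.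
by under eq_fun do rewrite row_mxEr; exact: measurable_coord.
Qed.

Lemma row_mx_scalar00 n x (v : 'rV[R]_n) : (row_mx x%:M v : 'rV_(1 + n)) 0 0 = x.
Proof.
have -> : (0 : 'I_(1 + n)) = lshift n 0 by exact: val_inj.
by rewrite row_mxEl mxE.
Qed.

(** The first coordinate is fixed, so each slice is transformed by its own volume preserving map;
    the joint measurability serves the preimage as a whole. *)
Lemma vpres_slices n (f : R -> 'rV[R]_n -> 'rV[R]_n) :
  (forall i, measurable_fun setT (fun t : (1 + n).-tuple mR => f (rowt t 0 0) (rsubmx (rowt t)) 0 i : mR)) ->
  (forall x, vpres (f x)) ->
  vpres (fun y : 'rV[R]_(1 + n) => row_mx (lsubmx y) (f (y 0 0) (rsubmx y))).
Proof.
move=> mf fp X mX; split.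
  apply: (measurable_preimage_row _ mX) => i; case: (@split_ordP 1 n i) => j ->.
    under eq_fun do rewrite row_mxEl mxE.
    exact: measurable_coord.
  under eq_fun do rewrite row_mxEr; exact: mf.
rewrite !vol_slice; apply: eq_integral => x _.
have [_ <-] := fp x _ (rmeas_slice x mX); congr vol; apply/seteqP; split=> v /=.
  by rewrite row_mxKl row_mxKr row_mx_scalar00.
by rewrite row_mxKl row_mxKr row_mx_scalar00.
Qed.

Lemma rsubmx_rowt n (t : (1 + n).-tuple mR) : rsubmx (rowt t) = rowt [tuple of behead t].
Proof.
by rewrite [in LHS](tuple_eta t) rowt_cons row_mxKr; congr rowt; exact: val_inj.
Qed.

(** Here the tail is fixed: integrating over it first leaves a translation of the line by [g] of the
    tail. *)
Lemma vpres_upper n (g : 'rV[R]_n -> R) :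
  measurable_fun setT (fun t : n.-tuple mR => g (rowt t) : mR) ->
  vpres (fun y : 'rV[R]_(1 + n) => row_mx (lsubmx y + (g (rsubmx y))%:M) (rsubmx y)).
Proof.
move=> mg X mX.
have mX' : rmeas ((fun y : 'rV[R]_(1 + n) => row_mx (lsubmx y + (g (rsubmx y))%:M) (rsubmx y)) @^-1` X).
  apply: (measurable_preimage_row _ mX) => i; case: (@split_ordP 1 n i) => j ->.
    rewrite (_ : (fun _ => _) = fun t : (1 + n).-tuple mR =>
        rowt t 0 (lshift n j) + g (rowt [tuple of behead t])).
      apply: measurable_funD; first exact: measurable_coord.
      exact: (measurableT_comp mg (@measurable_behead _ _ n)).
    apply/funext => t; rewrite row_mxEl rsubmx_rowt [LHS]mxE; congr (_ + _).
      by rewrite [LHS]mxE.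
    by rewrite ord1 mxE.
  under eq_fun do rewrite row_mxEr mxE.
  exact: measurable_coord.
split=> //; rewrite !vol_fubini//; apply: eq_integral => t _ /=.
rewrite -[RHS](@lebesgue_measure_translate _ (g (rowt t))).
  congr (lebesgue_measure _); apply/seteqP; split=> x /=.
    by rewrite row_mxKl row_mxKr -raddfD.
  by rewrite row_mxKl row_mxKr -raddfD.
rewrite -/(_ @^-1` X); apply: (measurable_preimage_row _ mX) => i; case: (@split_ordP 1 n i) => j ->.
  by under eq_fun do rewrite row_mxEl mxE ord1 eqxx mulr1n; exact: measurable_id.
by under eq_fun do rewrite row_mxEr; exact: measurable_cst.
Qed.

Lemma vpres_translate n (c : 'rV[R]_n) : vpres (fun y => y + c).
Proof.
elim: n c => [|n ih] c.
  by move=> X mX; rewrite (_ : _ @^-1` _ = X)//; apply/seteqP; split=> x /=; rewrite [x + c]thinmx0 [x]thinmx0.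
change n.+1 with (1 + n)%N in c |- *.
apply: (@vpres_ext _ ((fun y : 'rV[R]_(1 + n) => row_mx (lsubmx y + (c 0 (lshift n 0))%:M) (rsubmx y)) \o
    (fun y : 'rV[R]_(1 + n) => row_mx (lsubmx y) (rsubmx y + rsubmx c)))).
  move=> y /=; rewrite row_mxKl row_mxKr; apply/rowP => i; case: (split_ordP i) => j ->.
    by rewrite row_mxEl !mxE ord1 eqxx mulr1n.
  by rewrite row_mxEr !mxE.
apply: vpres_comp.
  apply: (@vpres_upper _ (fun=> c 0 (lshift n 0))); exact: measurable_cst.
apply: (@vpres_slices _ (fun _ v => v + rsubmx c)) => // i.
under eq_fun do rewrite mxE.
apply: measurable_funD; last exact: measurable_cst.
by under eq_fun do rewrite mxE; exact: measurable_coord.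
Qed.

Lemma vpres_lower_shear n (b : 'rV[R]_n) :
  vpres (mulmxr (block_mx 1%:M b 0 1%:M : 'M[R]_(1 + n))).
Proof.
apply: (@vpres_ext _ (fun y : 'rV[R]_(1 + n) => row_mx (lsubmx y) (rsubmx y + y 0 0 *: b))).
  move=> y /=; rewrite -[y in RHS]hsubmxK mul_row_block !mulmx1 mulmx0 addr0; congr row_mx.
  rewrite addrC; congr (_ + _).
  rewrite [X in X *m _]mx11_scalar mul_scalar_mx; congr (_ *: _).
  by rewrite mxE; congr (y 0 _); exact: val_inj.
apply: (@vpres_slices _ (fun x v => v + x *: b)) => [i|x]; last exact: vpres_translate.
under eq_fun do rewrite mxE [X in X + _]mxE [X in _ + X]mxE.
apply: measurable_funD; first exact: measurable_coord.
apply: measurable_funM; last exact: measurable_cst.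
exact: measurable_coord.
Qed.

Lemma vpres_upper_shear n (c : 'cV[R]_n) :
  vpres (mulmxr (block_mx 1%:M 0 c 1%:M : 'M[R]_(1 + n))).
Proof.
apply: (@vpres_ext _ (fun y : 'rV[R]_(1 + n) => row_mx (lsubmx y + (dot (rsubmx y) c)%:M) (rsubmx y))).
  move=> y /=; rewrite -[y in RHS]hsubmxK mul_row_block !mulmx1 mulmx0 add0r; congr row_mx.
  by congr (_ + _); rewrite [RHS]mx11_scalar.
apply: (@vpres_upper _ (fun v => dot v c)); exact: measurable_mulmx.
Qed.

Lemma vpres_block n (D : 'M[R]_n) : vpres (mulmxr D) ->
  vpres (mulmxr (block_mx 1%:M 0 0 D : 'M[R]_(1 + n))).
Proof.
move=> pD.
apply: (@vpres_ext _ (fun y : 'rV[R]_(1 + n) => row_mx (lsubmx y) (rsubmx y *m D))).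
  by move=> y /=; rewrite -[y in RHS]hsubmxK mul_row_block !mulmx0 mulmx1 addr0 add0r.
apply: (@vpres_slices _ (fun _ v => v *m D)) => // i.
under eq_fun do rewrite rsubmx_rowt.
exact: (measurableT_comp (measurable_mulmx D i) (@measurable_behead _ _ n)).
Qed.

Lemma vpres_mul n (B C : 'M[R]_n) : vpres (mulmxr B) -> vpres (mulmxr C) -> vpres (mulmxr (B *m C)).
Proof.
move=> pB pC; apply: (@vpres_ext _ (mulmxr C \o mulmxr B)); last exact: vpres_comp.
by move=> y /=; rewrite mulmxA.
Qed.

(* With an upper left entry 1, block elimination writes the matrix as a product of
   shears and a block matrix; one or two shears create this entry. *)
Lemma vpres_SL n (B : 'M[R]_n) : \det B = 1 -> vpres (mulmxr B).
Proof.
have ext1 m : vpres (mulmxr (1%:M : 'M[R]_m)).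
  apply: (@vpres_ext _ id); first by move=> y /=; rewrite mulmx1.
  by move=> X mX; split.
elim: n B => [|n ih] B detB; first by rewrite (_ : B = 1%:M) //; apply/matrixP => -[].
change n.+1 with (1 + n)%N in B, detB |- *.
pose L (b : 'rV[R]_n) : 'M[R]_(1 + n) := block_mx 1%:M b 0 1%:M.
pose U (c : 'cV[R]_n) : 'M[R]_(1 + n) := block_mx 1%:M 0 c 1%:M.
have LK b : L b *m L (- b) = 1%:M.
  rewrite mulmx_block !mulmx1 !mul1mx !mulmx0 !mul0mx !addr0 addNr add0r.
  by rewrite -scalar_mx_block.
have UK c : U c *m U (- c) = 1%:M.
  rewrite mulmx_block !mulmx1 !mul1mx !mulmx0 !mul0mx !addr0 ?add0r subrr.
  by rewrite -scalar_mx_block.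
have detL b : \det (L b) = 1 by rewrite det_ublock !det1 mulr1.
have detU c : \det (U c) = 1 by rewrite det_lblock !det1 mulr1.
have case1 (C : 'M[R]_(1 + n)) : \det C = 1 -> ulsubmx C = 1%:M -> vpres (mulmxr C).
  move=> detC C1.
  (* The Schur complement of the entry 1; it has determinant 1, so the induction hypothesis
     applies. *)
  pose D := drsubmx C - dlsubmx C *m ursubmx C.
  have CE : C = U (dlsubmx C) *m block_mx 1%:M 0 0 D *m L (ursubmx C).
    rewrite -{1}[C]submxK C1 /U /L !mulmx_block.
    by rewrite !mulmx1 !mul1mx !mulmx0 !mul0mx ?addr0 ?add0r mul1mx /D addrC subrK.
  rewrite CE; apply: vpres_mul; last exact: vpres_lower_shear.
  apply: vpres_mul; first exact: vpres_upper_shear.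
  apply/vpres_block/ih; move: detC; rewrite CE !det_mulmx detL detU det_ublock det1.
  by rewrite !mul1r mulr1.
have case2 (C : 'M[R]_(1 + n)) : \det C = 1 -> ursubmx C != 0 -> vpres (mulmxr C).
  move=> detC /matrix0Pn[i [j]]; rewrite ord1 => bj.
  (* Adding this multiple of the column of a nonzero entry turns the upper left entry into 1. *)
  pose w : 'cV[R]_n := ((1 - ulsubmx C 0 0) / ursubmx C 0 j) *: delta_mx j 0.
  have -> : C = (C *m U w) *m U (- w) by rewrite -mulmxA UK mulmx1.
  apply: vpres_mul; last exact: vpres_upper_shear.
  apply: case1; first by rewrite det_mulmx detC detU mulr1.
  rewrite -[C]submxK /U mulmx_block block_mxKul mulmx1.
  rewrite [LHS]mx11_scalar; congr _%:M; rewrite mxE.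
  rewrite /w -scalemxAr -colE [X in _ + X]mxE [X in _ * X]mxE divfK//.
  by rewrite addrC subrK.
have [b0|] := eqVneq (ursubmx B) 0; last exact: case2.
case: n => [|n] in ih B detB L U LK UK detL detU case1 case2 b0 *.
  apply: case1 => //.
  rewrite [LHS]mx11_scalar; congr _%:M.
  move: detB; rewrite -[B in \det B]submxK b0 det_lblock.
  by rewrite [drsubmx B]thinmx0 det_mx00 mulr1 {1}[ulsubmx B]mx11_scalar det_scalar1.
(* With a vanishing upper right block the corner entry is nonzero, so this shear copies it into that
   block and reduces to [case2]. *)
have -> : B = (B *m L (delta_mx 0 0)) *m L (- delta_mx 0 0) by rewrite -mulmxA LK mulmx1.
apply: vpres_mul; last exact: vpres_lower_shear.
apply: case2; first by rewrite det_mulmx detB detL mulr1.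
have ul_neq0 : ulsubmx B 0 0 != 0.
  apply: contra_eq_neq detB => ul0.
  by rewrite -[B]submxK b0 det_lblock [ulsubmx B]mx11_scalar det_scalar1 ul0 mul0r eq_sym oner_eq0.
rewrite -[B]submxK b0 /L mulmx_block block_mxKur mul0mx addr0 [ulsubmx B]mx11_scalar mul_scalar_mx.
by apply/matrix0Pn; exists 0, 0; rewrite mxE [X in _ * X]mxE !eqxx mulr1.
Qed.

End Volume.

(** * Volume of polytopes: finiteness, valuation property, invariance *)

Section VolumeOfPolytopes.
Context {R : realType}.
Notation mR := (measurableTypeR R).
Notation mu n := (@tuple_measure R n).

Lemma rmeasI n (A B : set 'rV[R]_n) : rmeas A -> rmeas B -> rmeas (A `&` B).
Proof. by move=> ? ?; rewrite /rmeas preimage_setI; exact: measurableI. Qed.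

Lemma rmeas_halfspace n (h : 'cV[R]_n) c : rmeas [set x | dot x h <= c].
Proof.
have := @measurable_mulmx R n 1 h 0 measurableT `]-oo, c]%classic (measurable_itv _).
by rewrite setTI; congr measurable; apply/seteqP; split=> t /=; rewrite in_itv.
Qed.

Definition polyhedron n (L : seq ('cV[R]_n * R)) (e : R) : set 'rV[R]_n :=
  [set x | forall p, p \in L -> dot x p.1 <= p.2 + e].

Lemma rmeas_polyhedron n (L : seq ('cV[R]_n * R)) e : rmeas (polyhedron L e).
Proof.
elim: L => [|p L ih].
  by rewrite (_ : polyhedron _ _ = setT) ?/rmeas ?preimage_setT//; apply/seteqP.
rewrite (_ : polyhedron _ _ = [set x | dot x p.1 <= p.2 + e] `&` polyhedron L e).
  by apply: rmeasI => //; exact: rmeas_halfspace.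
apply/seteqP; split=> x.
  move=> xL; split; first by apply: xL; rewrite mem_head.
  by move=> q qL; apply: xL; rewrite in_cons qL orbT.
by move=> [xp xL] q; rewrite in_cons => /orP[/eqP ->//|]; exact: xL.
Qed.

Lemma polytope0_polyhedron n (P : polytope0 R n) : exists L, P = polyhedron L 0 :> set _.
Proof.
have [ls [ms ->]] := polytope0_halfspaces P.
exists ([seq (l, 1) | l <- ls] ++ [seq (m, 0) | m <- ms]).
apply/seteqP; split=> x.
  move=> [x1 x2] p; rewrite mem_cat addr0 => /orP[] /mapP[h hL ->]/=; first exact: x1.
  exact: x2.
move=> xL; split=> h hL.
  have := xL (h, 1); rewrite addr0; apply; rewrite mem_cat; apply/orP; left.
  by apply/mapP; exists h.
have := xL (h, 0); rewrite addr0; apply; rewrite mem_cat; apply/orP; right.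
by apply/mapP; exists h.
Qed.

Lemma rmeas_polytope0 n (P : polytope0 R n) : rmeas P.
Proof. by have [L ->] := polytope0_polyhedron P; exact: rmeas_polyhedron. Qed.

Definition box n (a b : 'I_n -> R) : set 'rV[R]_n :=
  [set x | forall i, a i <= x 0 i <= b i].

Lemma dot_delta n (x : 'rV[R]_n) i : dot x (delta_mx i 0) = x 0 i.
Proof. by rewrite /dot -colE mxE. Qed.

Lemma box_polyhedron n (a b : 'I_n -> R) : exists L, forall e,
  box (fun i => a i - e) (fun i => b i + e) = polyhedron L e.
Proof.
exists ([seq (delta_mx i 0, b i) | i <- enum 'I_n] ++ [seq (- delta_mx i 0, - a i) | i <- enum 'I_n]).
move=> e; apply/seteqP; split=> x.
  move=> xab p; rewrite mem_cat => /orP[] /mapP[i _ ->]/=; rewrite ?dotNr dot_delta.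
    by have /andP[] := xab i.
  by rewrite lerNl opprD opprK; have /andP[] := xab i.
move=> xL i; apply/andP; split.
  have := xL (- delta_mx i 0, - a i); rewrite dotNr dot_delta lerNl opprD opprK; apply.
  by rewrite mem_cat; apply/orP; right; apply/mapP; exists i; rewrite ?mem_enum.
have := xL (delta_mx i 0, b i); rewrite dot_delta; apply.
by rewrite mem_cat; apply/orP; left; apply/mapP; exists i; rewrite ?mem_enum.
Qed.

Lemma rmeas_box n (a b : 'I_n -> R) : rmeas (box a b).
Proof.
have [L /(_ 0)] := box_polyhedron a b.
under eq_fun do rewrite subr0; under [X in box _ X]eq_fun do rewrite addr0.
by move=> ->; exact: rmeas_polyhedron.
Qed.

Lemma vol_box n (a b : 'I_n -> R) : (forall i, a i <= b i) ->
  vol (box a b) = (\prod_i (b i - a i))%:E.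
Proof.
elim: n a b => [|n ih] a b ab.
  rewrite big_ord0 /vol -tuple_measureE /= diracE mem_set//=.
  by case.
pose a' i := a (lift ord0 i); pose b' i := b (lift ord0 i).
rewrite /vol -tuple_measureE /= /pushforward tuple_measureE.
rewrite (_ : _ @^-1` _ = `[a ord0, b ord0]%classic `*` (@rowt R n @^-1` (box a' b'))).
  rewrite product_measure1E//; last exact: rmeas_box.
  rewrite [X in (_ * X)%E](ih a' b') => [|i]; last exact: ab.
  rewrite [X in (X * _)%E](lebesgue_measure_itv `[a ord0, b ord0])/= lte_fin big_ord_recl.
  have := ab ord0; rewrite le_eqVlt => /orP[/eqP ->|->]; last by rewrite -EFinB -EFinM.
  by rewrite ltxx subrr mul0r mul0e.
apply/seteqP; split=> -[x t] /=.
  move=> xt; split; first by have := xt ord0; rewrite mxE in_itv.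
  by move=> i; have := xt (lift ord0 i); rewrite !mxE tnthS.
rewrite in_itv/= => -[xt tt] i; case: (unliftP ord0 i) => [j|] ->; rewrite mxE//.
by have := tt j; rewrite mxE tnthS.
Qed.

Lemma le_vol n (A B : set 'rV[R]_n) : rmeas A -> rmeas B -> A `<=` B -> (vol A <= vol B)%E.
Proof. by move=> mA mB AB; apply: le_measure; rewrite ?inE// => t; exact: AB. Qed.

Lemma polytope0_box n (P : polytope0 R n) :
  exists2 K : R, 0 <= K & (P : set _) `<=` box (fun=> - K) (fun=> K).
Proof.
have [K PK] := polytope_bounded (polytope0P P); exists K.
  by rewrite -(@enorm0 R n); apply: PK; exact: polytope0_0.
move=> x /PK xK i; rewrite -ler_norml; apply: le_trans xK; exact: coord_le_enorm.
Qed.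

Lemma vol_polytope0_fin n (P : polytope0 R n) : vol P \is a fin_num.
Proof.
have [K K0 PK] := polytope0_box P.
rewrite ge0_fin_numE//.
apply: le_lt_trans (le_vol (rmeas_polytope0 P) (rmeas_box _ _) PK) _.
by rewrite vol_box ?ltry// => _; rewrite lerNl (le_trans _ K0)// oppr_le0.
Qed.

Lemma volume_valuation n : valuation (fun P : polytope0 R n => volume P).
Proof.
move=> P Q PQ PnQ PQE PnQE; rewrite !volumeE -!fineD ?vol_polytope0_fin//; congr fine.
rewrite PQE PnQE /vol preimage_setU preimage_setI.
have mP := rmeas_polytope0 P; have mQ := rmeas_polytope0 Q.
have finI : (mu n (@rowt R n @^-1` P `&` @rowt R n @^-1` Q) < +oo)%E.
  rewrite -preimage_setI -PnQE -ge0_fin_numE//; exact: vol_polytope0_fin.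
rewrite measureUfinl//; last by rewrite -ge0_fin_numE//; exact: vol_polytope0_fin.
by rewrite subeK// ge0_fin_numE.
Qed.

Lemma volume_SL n : sl_invariant (fun P : polytope0 R n => volume P).
Proof.
move=> A detA P /=; rewrite !volumeE; congr fine.
have detAt : \det A^T = 1 by rewrite det_tr.
have uA : A^T \in unitmx by rewrite unitmxE detAt unitr1.
(* The image under [A] is the preimage under the inverse of [A^T]. *)
have := @vpres_SL R n (invmx A^T).
rewrite det_inv detAt invr1 => /(_ erefl _ (rmeas_polytope0 P))[_ <-]; congr vol.
apply/seteqP; split=> [_ [x Px <-]|x /= Px].
  by rewrite /= mulmxK.
by exists (x *m invmx A^T) => //; rewrite mulmxKV.
Qed.

End VolumeOfPolytopes.

(** * Hausdorff balls and Borel measurability of the volume *)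

Section HausdorffBalls.
Context {R : realType} {n : nat}.
Implicit Types P Q : polytope0 R n.

Lemma ball_polytope0 P Q (e : R) : ball P e Q ->
  (forall x, (P : set _) x -> exists2 y, (Q : set _) y & enorm (x - y) <= e) /\
  (forall y, (Q : set _) y -> exists2 x, (P : set _) x & enorm (x - y) <= e).
Proof.
rewrite ballEmdist/= => PQe.
have [M MP] := polytope_bounded (polytope0P P).
have [N NQ] := polytope_bounded (polytope0P Q).
have M0 : 0 <= M by rewrite -(@enorm0 R n); apply: MP; exact: polytope0_0.
have N0 : 0 <= N by rewrite -(@enorm0 R n); apply: NQ; exact: polytope0_0.
have e0 : 0 < e - mdist P Q by rewrite subr_gt0.
have [|d [d0 d1 d2]] := inf_adherent e0 (E := [set e | [/\ 0 <= e,
     forall x, (P : set _) x -> exists2 y, (Q : set _) y & enorm (x - y) <= e &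
     forall y, (Q : set _) y -> exists2 x, (P : set _) x & enorm (x - y) <= e]]).
  split; last by exists 0 => ? [].
  exists (M + N); split; first exact: addr_ge0.
  - move=> x Px; exists 0; first exact: polytope0_0.
    by rewrite subr0 (le_trans (MP _ Px))// lerDl.
  - move=> y Qy; exists 0; first exact: polytope0_0.
    by rewrite sub0r enormN (le_trans (NQ _ Qy))// lerDr.
rewrite -[inf _]/(mdist P Q) addrC subrK => de; split.
- by move=> x /d1[y Qy xy]; exists y => //; rewrite (le_trans xy)// ltW.
- by move=> x /d2[y Qy xy]; exists y => //; rewrite (le_trans xy)// ltW.
Qed.

Lemma polytope0_ball P Q (d e : R) : 0 <= d -> d < e ->
  (forall x, (P : set _) x -> exists2 y, (Q : set _) y & enorm (x - y) <= d) ->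
  (forall y, (Q : set _) y -> exists2 x, (P : set _) x & enorm (x - y) <= d) ->
  ball P e Q.
Proof.
move=> d0 de PQ QP; rewrite ballEmdist/=; apply: le_lt_trans de.
by apply: ge_inf => //; exists 0 => ? [].
Qed.

Lemma polytope0_openP (A : set (polytope0 R n)) :
  (forall P, A P -> exists2 e : R, 0 < e & forall Q, ball P e Q -> A Q) -> open A.
Proof.
move=> Aball; rewrite openE => P /Aball[e e0 eA].
by apply/nbhs_ballP; exists e.
Qed.

HB.instance Definition _ := isPointed.Build (polytope0 R n) (corner_poly (0 : 'M[R]_(0, n))).

Notation bT := (g_sigma_algebraType (@open (polytope0 R n))).

Lemma borel_measurableP (Psi : polytope0 R n -> R) :
  borel_measurable Psi <-> measurable_fun [set: bT] (Psi : bT -> R).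
Proof.
split=> [mPsi|mPsi U oU].
  apply: (measurability _ (RGenInftyO.measurableE R)).
  move=> _ [_ [x ->] <-]; rewrite setTI; exact: (mPsi _ (interval_open _ _)).
have := mPsi measurableT U (open_measurable oU).
by rewrite setTI.
Qed.

Lemma norm_dot_le x (h : 'cV[R]_n) : `|dot x h| <= enorm x * enorm h^T.
Proof.
rewrite ler_norml; have dE y : dot y h = \sum_i y 0 i * h^T 0 i.
  by rewrite /dot mxE; apply: eq_bigr => i _; rewrite mxE.
rewrite !dE cauchy_schwarz andbT lerNl -sumrN -[enorm x]enormN.
apply: le_trans (cauchy_schwarz _ _); apply: ler_sum => i _.
by rewrite -mulNr [X in _ <= X * _]mxE.
Qed.

(* Relaxing all facet inequalities by 1/(k+1) gives polyhedra decreasing to [P],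
   each of which contains all polytopes close enough to [P]. *)
Lemma volume_usc P (a : R) : volume P < a ->
  exists2 e : R, 0 < e & forall Q, ball P e Q -> volume Q < a.
Proof.
move=> Pa.
have [L PL] := polytope0_polyhedron P.
have [K K0 PK] := polytope0_box P.
have [L' bL'] := @box_polyhedron R n (fun=> - K) (fun=> K).
(* The constraints of a bounding box give [F 0] finite volume, as continuity of the measure from
   above demands. *)
pose F (k : nat) := polyhedron (L ++ L') (k.+1%:R^-1).
have Fbox : F 0%N `<=` box (fun=> - K - 1) (fun=> K + 1).
  move=> x xF; have /seteqP[_] := bL' 1; apply=> p pL'.
  by have := xF p; rewrite mem_cat pL' orbT invr1; apply.
have nearF x p : (forall k, dot x p.1 <= p.2 + k.+1%:R^-1) -> dot x p.1 <= p.2.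
  move=> xp; apply/ler_addgt0Pr => e e0.
  have [k _ /(_ k (leqnn _)) ke] := near_infty_natSinv_lt (PosNum e0).
  by apply: le_trans (xp k) _; rewrite lerD2l ltW.
have capF : \bigcap_k F k = P.
  apply/seteqP; split=> x.
    move=> xF; rewrite PL => p pL; rewrite addr0; apply: nearF => k.
    by apply: (xF k I); rewrite mem_cat pL.
  move=> Px k _ p; rewrite mem_cat => /orP[pL|pL'].
    have /seteqP[/(_ x Px) + _] := PL; move=> /(_ p pL); rewrite addr0 => /le_trans; apply.
    by rewrite lerDl invr_ge0.
  have /seteqP[+ _] := bL' 0 => /(_ x) h.
  have /(_ p pL') : polyhedron L' 0 x.
    by apply: h => i; rewrite subr0 addr0; exact: PK.
  by rewrite addr0 => /le_trans; apply; rewrite lerDl invr_ge0.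
have Fcvg : (fun k => vol (F k)) @ \oo --> vol (P : set 'rV[R]_n).
  rewrite -capF; apply: (@nonincreasing_cvg_mu _ _ _ (@tuple_measure R n) (fun k => @rowt R n @^-1` F k)).
  - apply: le_lt_trans (le_vol (rmeas_polyhedron _ _) (rmeas_box _ _) Fbox) _.
    by rewrite vol_box ?ltry// => _; lra.
  - move=> k; exact: rmeas_polyhedron.
  - by rewrite -preimage_bigcap capF; exact: rmeas_polytope0.
  - move=> k m km; apply/subsetPset => t tF p pL; apply: le_trans (tF _ pL) _.
    by rewrite lerD2l lef_pV2 ?posrE// ler_nat.
have [k vk] : exists k, (vol (F k) < a%:E)%E.
  have Pa' : (vol (P : set 'rV[R]_n) < a%:E)%E.
    by rewrite -(fineK (vol_polytope0_fin P)) lte_fin -volumeE.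
  have : \forall k \near \oo, (vol (F k) < a%:E)%E := Fcvg _ (open_ereal_lt' Pa').
  by move=> /filter_ex[k kP]; exists k.
pose C := \sum_(p <- L ++ L') enorm p.1^T.
have C0 : 0 <= C by apply: sumr_ge0 => p _; exact: enorm_ge0.
(* [C] bounds the norm of every normal, so a displacement of this size changes each constraint by at
   most [k.+1%:R^-1]. *)
exists (k.+1%:R^-1 / (C + 1)) => [|Q /ball_polytope0[_ QP]].
  by rewrite divr_gt0// ltr_wpDl.
have QF : (Q : set _) `<=` F k.
  move=> y /QP[x Px xy] p pL.
  have xF : (\bigcap_k F k) x by rewrite capF.
  have xp : dot x p.1 <= p.2 by apply: nearF => m; exact: xF.
  have -> : y = x - (x - y) by rewrite opprB addrC subrK.
  rewrite dotDl dotNl; apply: lerD => //.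
  apply: le_trans (_ : enorm (x - y) * enorm p.1^T <= _).
    by apply: le_trans (norm_dot_le _ _); rewrite -normrN ler_norm.
  apply: le_trans (_ : k.+1%:R^-1 / (C + 1) * (C + 1) <= _); last first.
    by rewrite divfK// gt_eqF// ltr_wpDl.
  apply: ler_pM => //; rewrite ?enorm_ge0//.
  rewrite /C (big_rem p)//= -addrA lerDl addr_ge0// sumr_ge0// => *; exact: enorm_ge0.
rewrite volumeE -lte_fin fineK ?vol_polytope0_fin//.
by apply: le_lt_trans vk; apply: le_vol => //; [exact: rmeas_polytope0|exact: rmeas_polyhedron].
Qed.

Lemma volume_borel : borel_measurable (fun P : polytope0 R n => volume P).
Proof.
apply/borel_measurableP; apply: (measurability _ (RGenInftyO.measurableE R)).
move=> _ [_ [a ->] <-]; rewrite setTI; apply: sub_sigma_algebra.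
apply: polytope0_openP => P /=; rewrite in_itv/= => /volume_usc[e e0 eP].
by exists e => // Q /eP; rewrite in_itv.
Qed.

End HausdorffBalls.

(** * Measurable additive functions *)

Section Cauchy.
Context {R : realType}.
Notation mR := (measurableTypeR R).
Implicit Types (g : R -> R) (x y : R).

Definition pos_additive g := forall x y, 0 < x -> 0 < y -> g (x + y) = g x + g y.

Lemma pos_additive_muln g x n : pos_additive g -> 0 < x -> g (n.+1%:R * x) = n.+1%:R * g x.
Proof.
move=> ga x0; elim: n => [|n ih]; first by rewrite !mul1r.
have -> : n.+2%:R = n.+1%:R + 1 :> R by rewrite -natr1.
by rewrite !mulrDl !mul1r ga ?ih// mulr_gt0.
Qed.

(** The difference [h] with the linear function is zero at 1, hence at 1/8, hence invariant under
    steps of 1/8; the bound near 0 becomes global, and a bounded additive function vanishes. *)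
Lemma pos_additive_bounded g (B : R) : pos_additive g ->
  (forall x, 0 < x < 4^-1 -> `|g x| <= B) -> forall x, 0 < x -> g x = x * g 1.
Proof.
move=> ga gB.
pose h x := g x - x * g 1.
have ha : pos_additive h by move=> x y x0 y0; rewrite /h ga//; ring.
pose C := B + `|g 1|.
have hC x : 0 < x < 4^-1 -> `|h x| <= C.
  move=> x4; rewrite (le_trans (ler_normB _ _))// lerD ?gB//.
  have /andP[x0 x1] := x4.
  by rewrite normrM ler_piMl// ger0_norm ?ltW//; lra.
have h8 : h 8^-1 = 0.
  have := @pos_additive_muln h 8^-1 7 ha; rewrite mulfV// => /(_ _)/esym h1.
  have : 8 * h 8^-1 = 0 by rewrite h1 ?invr_gt0// /h mul1r subrr.
  by move/eqP; rewrite mulf_eq0 pnatr_eq0/= => /eqP.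
have hCn n x : 0 < x -> x < n%:R / 8 + 4^-1 -> `|h x| <= C.
  elim: n x => [|n ih] x x0 xn; first by apply: hC; rewrite x0/=; move: xn; rewrite mul0r add0r.
  have [x4|x4] := ltP x 4^-1; first by apply: hC; rewrite x0.
  have -> : x = (x - 8^-1) + 8^-1 by rewrite subrK.
  rewrite ha ?h8 ?addr0 ?invr_gt0//; last by lra.
  apply: ih; first by lra.
  by move: xn; rewrite -natr1; lra.
have {}hC x : 0 < x -> `|h x| <= C.
  move=> x0; apply: (hCn (Num.bound (8 * x)) x x0).
  have := archi_boundP (ltW (mulr_gt0 (ltr0n R 8) x0)); lra.
move=> x x0; apply/eqP; rewrite -subr_eq0 -/(h x) -normr_le0 leNgt; apply/negP => hx.
have := hC (((Num.bound (C / `|h x|)).+1)%:R * x).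
rewrite pos_additive_muln// normrM ger0_norm// leNgt => /(_ _)/negP; apply.
  by rewrite mulr_gt0.
have C0 : 0 <= C by apply: le_trans (hC _ x0).
have := archi_boundP (divr_ge0 C0 (ltW hx)).
rewrite ltr_pdivrMr// => /lt_le_trans; apply.
by rewrite ler_pM2r// ler_nat.
Qed.

(* A set of measure more than 3/4 in the unit interval meets its translates by
   less than 1/4, which bounds the function on ]0, 1/4[. *)
Lemma measurable_pos_additive g : measurable_fun [set: mR] (g : mR -> mR) ->
  pos_additive g -> forall x, 0 < x -> g x = x * g 1.
Proof.
move=> mg ga.
(* These sets exhaust the unit interval, so one of them has measure above 3/4. *)
pose E (k : nat) : set mR := `]0, 1[%classic `&` (Num.norm \o g) @^-1` `]-oo, k%:R]%classic.
have mE k : measurable (E k).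
  apply: measurableI; first exact: measurable_itv.
  rewrite -[X in measurable X]setTI; apply: (measurableT_comp (f := Num.norm : mR -> mR)) => //.
have capE : \bigcup_k E k = `]0, 1[%classic.
  apply/seteqP; split=> [x [k _ []]//|x x01].
  exists (Num.bound `|g x|) => //; split=> //=; rewrite in_itv/= ltW//.
  exact: archi_boundP.
have [k Ek] : exists k, ((3 / 4)%:E < @lebesgue_measure R (E k))%E.
  have Ecvg : (lebesgue_measure \o E) @ \oo --> @lebesgue_measure R (\bigcup_k E k).
    apply: nondecreasing_cvg_mu => //.
      by rewrite capE; exact: measurable_itv.
    move=> k m km; apply/subsetPset => x [x01] /=; rewrite !in_itv/= => xk; split=> //=.
    by rewrite in_itv/= (le_trans xk)// ler_nat.
  have l : ((3 / 4)%:E < @lebesgue_measure R (\bigcup_k E k))%E.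
    rewrite capE lebesgue_measure_itv/= lte_fin ltr01 -EFinB lte_fin; lra.
  have : \forall k \near \oo, ((3 / 4)%:E < @lebesgue_measure R (E k))%E := Ecvg _ (open_ereal_gt' l).
  by move=> /filter_ex[k kP]; exists k.
apply: (@pos_additive_bounded _ (k%:R + k%:R)) => // x /andP[x0 x4].
have [y [[y01 gy] [xy01 gxy]]] : E k `&` [set y | E k (y + x)] !=set0.
  (* Disjoint, the set and its translate would have total measure above 3/2 inside an interval of
     length 5/4. *)
  apply/set0P/eqP => disj.
  pose Ex : set mR := [set y | E k (y + x)].
  have mEx : measurable Ex.
    rewrite -[X in measurable X]setTI.
    have mf : measurable_fun setT (fun y : mR => y + x : mR) by apply: measurable_funD.
    exact: mf.
  have := @measureU _ _ _ (@lebesgue_measure R) _ _ (mE k) mEx disj.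
  rewrite [X in (_ + X)%E]lebesgue_measure_translate// => EU.
  have : (lebesgue_measure (E k `|` Ex) <=
      @lebesgue_measure R `](-4^-1)%R, 1%R[%classic)%E.
    apply: le_measure; rewrite ?inE; [exact: measurableU|exact: measurable_itv|].
    move=> y [[+ _]|[+ _]]; rewrite /= !in_itv/= => /andP[? ?]; apply/andP; split; lra.
  rewrite EU lebesgue_measure_itv/= lte_fin ifT; last lra.
  rewrite -EFinB leNgt => /negP; apply.
  apply: (@lt_trans _ _ ((3 / 4)%:E + (3 / 4)%:E)%E); last exact: lteD.
  by rewrite -EFinD lte_fin; lra.
move: y01 gy xy01 gxy; rewrite /= !in_itv/= => /andP[y0 _] gy _ gxy.
have -> : g x = g (y + x) - g y by rewrite ga// addrAC subrr add0r.
by rewrite (le_trans (ler_normB _ _))// lerD.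
Qed.

End Cauchy.

(** * The sign of the relative interior at the origin *)

Section ConeDichotomy.
Context {R : realType} {n : nat}.
Notation V := 'rV[R]_n.
Implicit Types (C D : set V) (x y z : V).

Definition ccone C := [/\ C 0, forall x y, C x -> C y -> C (x + y) &
  forall a x, 0 < a -> C x -> C (a *: x)].

(** For a convex cone, this says that it is a linear subspace. *)
Definition csym C := forall x, C x -> C (- x).

Lemma cconeZ C a x : ccone C -> 0 < a -> C (a *: x) -> C x.
Proof.
move=> [_ _ CZ] a0 Cax; have -> : x = a^-1 *: (a *: x) by rewrite scalerA mulVf ?scale1r ?gt_eqF.
by apply: CZ; rewrite ?invr_gt0.
Qed.

Variables C D : set V.
Hypotheses (coneC : ccone C) (coneD : ccone D) (coneCD : ccone (C `|` D)).
(** The only topological input on the cones, supplied by [ray_meet]. *)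
Hypothesis meet : forall x y, C x -> D y ->
  exists2 t : R, 0 <= t <= 1 & (C `&` D) ((1 - t) *: x + t *: y).

Let C0 : C 0. Proof. by case: coneC. Qed.
Let CD x y : C x -> C y -> C (x + y). Proof. by case: coneC => _ + _; apply. Qed.
Let CZ a x : 0 < a -> C x -> C (a *: x). Proof. by case: coneC => _ _; apply. Qed.
Let D0 : D 0. Proof. by case: coneD. Qed.
Let DD x y : D x -> D y -> D (x + y). Proof. by case: coneD => _ + _; apply. Qed.
Let DZ a x : 0 < a -> D x -> D (a *: x). Proof. by case: coneD => _ _; apply. Qed.

Lemma meetP x y : C x -> D y -> D x \/ C y \/
  exists a b : R, [/\ 0 < a, 0 < b & (C `&` D) (a *: x + b *: y)].
Proof.
move=> Cx Dy; have [t /andP[t0 t1] z] := meet Cx Dy.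
move: t0; rewrite le_eqVlt => /orP[/eqP t0|t0].
  by left; move: z; rewrite -t0 subr0 scale1r scale0r addr0 => -[].
move: t1; rewrite le_eqVlt => /orP[/eqP t1|t1].
  by right; left; move: z; rewrite t1 subrr scale1r scale0r add0r => -[].
by right; right; exists (1 - t), t; split; rewrite ?subr_gt0.
Qed.

(** For [d] in [D] outside the subspace [C], a proper crossing point of the segment from [c] to [d]
    would put [d] in [C]; the crossing must be at [c] itself. *)
Lemma cone_sub_of_sym : csym C -> ~ (D `<=` C) -> C `<=` D.
Proof.
move=> sC /existsNP[d /not_implyP[Dd nCd]] c Cc.
have [//|[//|[a [b [a0 b0 [z _]]]]]] := meetP Cc Dd.
case: nCd; apply: (cconeZ coneC b0).
have -> : b *: d = (a *: c + b *: d) + a *: (- c) by rewrite scalerN addrAC subrr add0r.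
by apply: CD => //; apply: CZ => //; exact: sC.
Qed.

(** If the intersection were a subspace, crossing points could be negated: with [y0] in [D] but not
    [- y0], the crossing point of [x] and [y0] yields [- x] in [D], so the union would be
    symmetric. *)
Lemma meet_nsym : ~ csym (C `|` D) -> ~ csym C -> ~ csym D -> ~ csym (C `&` D).
Proof.
move=> nCD /existsNP[x0 /not_implyP[Cx0 nCx0]] /existsNP[y0 /not_implyP[Dy0 nDy0]] sS.
apply: nCD => x [Cx|Dx].
  have [Cnx|nCx] := pselect (C (- x)); first by left.
  right; have [Dx|[Cy0|[a [b [a0 b0 z]]]]] := meetP Cx Dy0.
  - by have [] := sS x (conj Cx Dx).
  - by have [] := sS y0 (conj Cy0 Dy0).
  apply: (cconeZ coneD a0); rewrite scalerN.
  have -> : - (a *: x) = - (a *: x + b *: y0) + b *: y0 by rewrite opprD addrNK.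
  by apply: DD; [have [] := sS _ z|exact: DZ].
have [Dnx|nDx] := pselect (D (- x)); first by right.
left; have [Dx0|[Cx|[a [b [a0 b0 z]]]]] := meetP Cx0 Dx.
- by have [] := sS x0 (conj Cx0 Dx0).
- by have [] := sS x (conj Cx Dx).
apply: (cconeZ coneC b0); rewrite scalerN.
have -> : - (b *: x) = - (a *: x0 + b *: x) + a *: x0 by rewrite opprD addrAC addNr add0r.
by apply: CD; [have [] := sS _ z|exact: CZ].
Qed.

Section ProperCover.
Hypothesis symCD : csym (C `|` D).
Variables (x0 y0 : V).
Hypotheses (Cx0 : C x0) (nDx0 : ~ D x0) (Dy0 : D y0) (nCy0 : ~ C y0).

(** If [z] is in both cones and [- z] only in [D], the crossing point of [x0] and [- z], plus a
    multiple of [z], puts [x0] in [D]. *)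
Lemma cover_sym_meet : csym (C `&` D).
Proof.
move=> z [Cz Dz]; split; apply: contrapT => nz.
  have Dnz : D (- z) by case: (symCD (or_introl Cz)).
  have [//|[//|[a [b [a0 b0 [_ w]]]]]] := meetP Cx0 Dnz.
  apply: nDx0; apply: (cconeZ coneD a0).
  have -> : a *: x0 = (a *: x0 + b *: (- z)) + b *: z by rewrite scalerN subrK.
  by apply: DD => //; exact: DZ.
have Cnz : C (- z) by case: (symCD (or_introl Cz)).
have [//|[//|[a [b [a0 b0 [w _]]]]]] := meetP Cnz Dy0.
apply: nCy0; apply: (cconeZ coneC b0).
have -> : b *: y0 = (a *: (- z) + b *: y0) + a *: z by rewrite scalerN addrAC addNr add0r.
by apply: CD => //; exact: CZ.
Qed.

(** If [C] were a subspace, [x0 + y0] and [x0 - y0] would be outside it, hence in [D], and so would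
    their sum [2 x0]. *)
Lemma cover_nsym : ~ csym C.
Proof.
move=> sC; apply: nDx0.
have Dw w : ~ C w -> (C `|` D) w -> D (x0 + w).
  move=> nCw CDw; have [_ CDD _] := coneCD.
  case: (CDD _ _ (or_introl Cx0) CDw) => // Cxw; case: nCw.
  have -> : w = (x0 + w) + (- x0) by rewrite addrAC subrr add0r.
  by apply: CD => //; exact: sC.
apply: (cconeZ coneD (ltr0n _ 2)).
have -> : 2%:R *: x0 = (x0 + y0) + (x0 + - y0) by rewrite addrACA subrr addr0 scaler_nat.
apply: DD; apply: Dw => //; first by right.
  by move=> /sC; rewrite opprK.
exact: (symCD (or_intror Dy0)).
Qed.

(** For [w] in [D] the crossing point with [x0] is such a translate up to scaling; for [w] in [C]
    either [w] is already in both cones or [- w] is in [D]. *)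
Lemma cover_codim1 w : (C `|` D) w -> exists r, (C `&` D) (w - r *: x0).
Proof.
have Dcase v : D v -> exists r, (C `&` D) (v - r *: x0).
  move=> Dv; have [//|[Cv|[a [b [a0 b0 z]]]]] := meetP Cx0 Dv.
    by exists 0; rewrite scale0r subr0.
  exists (- (a / b)); rewrite scaleNr opprK.
  have -> : v + a / b *: x0 = b^-1 *: (a *: x0 + b *: v).
    by rewrite scalerDr !scalerA mulVf ?gt_eqF// scale1r addrC mulrC.
  by split; [apply: CZ; [rewrite invr_gt0|case: z]|apply: DZ; [rewrite invr_gt0|case: z]].
case=> [Cw|]; last exact: Dcase.
have [Cnw|nCnw] := pselect (C (- w)).
  have [Dw|[//|[a [b [a0 b0 [z _]]]]]] := meetP Cw Dy0.
    by exists 0; rewrite scale0r subr0.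
  case: nCy0; apply: (cconeZ coneC b0).
  have -> : b *: y0 = (a *: w + b *: y0) + a *: (- w) by rewrite scalerN addrAC subrr add0r.
  by apply: CD => //; exact: CZ.
have Dnw : D (- w) by case: (symCD (or_introl Cw)).
have [r /cover_sym_meet] := Dcase _ Dnw.
by rewrite opprB opprK addrC => z; exists (- r); rewrite scaleNr opprK.
Qed.

End ProperCover.

End ConeDichotomy.

(** * Tangent cones at the origin *)

Section RayCone.
Context {R : realType} {n : nat}.
Implicit Types (P Q : polytope0 R n) (x y : 'rV[R]_n).

(* The tangent cone of a polytope [A] at its point 0. *)
Definition ray (A : set 'rV[R]_n) : set 'rV[R]_n := [set x | exists2 t : R, 0 < t & A (t *: x)].

Lemma ray_sub P x : (P : set _) x -> ray P x.
Proof. by move=> Px; exists 1; rewrite ?scale1r. Qed.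

Lemma ray_small P x : ray P x -> exists2 t : R, 0 < t & forall s, 0 <= s <= t -> (P : set _) (s *: x).
Proof.
move=> [t t0 Pt]; exists t => // s /andP[s0 st].
have -> : s *: x = (s / t) *: (t *: x) by rewrite scalerA divfK ?gt_eqF.
apply: polytope0_star => //; rewrite divr_ge0 ?(ltW t0)//=.
by rewrite ler_pdivrMr ?mul1r.
Qed.

Lemma ray_ccone P : ccone (ray P).
Proof.
split=> [|x y|a x a0].
- by apply: ray_sub; exact: polytope0_0.
- move=> /ray_small[s s0 sx] /ray_small[t t0 ty].
  pose r := Num.min s t / 2; have r0 : 0 < r by rewrite divr_gt0// lt_min s0.
  have mn : 0 < Num.min s t by rewrite lt_min s0.
  exists r => //; rewrite scalerDr.
  have -> : r *: x + r *: y = 2^-1 *: (Num.min s t *: x) + 2^-1 *: (Num.min s t *: y).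
    by rewrite !scalerA /r mulrC.
  apply: polytope0_convex; rewrite ?invr_ge0//; first by lra.
    by apply: sx; rewrite ge_min lexx (ltW mn).
  by apply: ty; rewrite ge_min lexx orbT (ltW mn).
- move=> [t t0 tx]; exists (t / a); first exact: divr_gt0.
  by rewrite scalerA divfK ?gt_eqF.
Qed.

Lemma rayU (P Q PQ : polytope0 R n) : PQ = (P : set _) `|` Q :> set _ -> ray PQ = ray P `|` ray Q.
Proof.
move=> E; rewrite E; apply/seteqP; split=> x; last first.
  by move=> [[t t0 xt]|[t t0 xt]]; exists t => //; [left|right].
by move=> [t t0 [xt|xt]]; [left|right]; exists t.
Qed.

Lemma rayI (P Q PQ : polytope0 R n) : PQ = (P : set _) `&` Q :> set _ -> ray PQ = ray P `&` ray Q.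
Proof.
move=> E; rewrite E; apply/seteqP; split=> x; first by move=> [t t0 [xt xt']]; split; exists t.
move=> [/ray_small[s s0 sx] /ray_small[t t0 ty]].
have mn : 0 < Num.min s t by rewrite lt_min s0.
exists (Num.min s t) => //; split.
  by apply: sx; rewrite ge_min lexx (ltW mn).
by apply: ty; rewrite ge_min lexx orbT (ltW mn).
Qed.

Lemma ball_enorm x y (e : R) : enorm (x - y) < e -> ball x e y.
Proof.
move=> xy; have e0 : 0 < e by apply: le_lt_trans xy; exact: enorm_ge0.
split => // i j; rewrite ord1 /ball/=.
by have := coord_le_enorm (x - y) j; rewrite !mxE => /le_lt_trans; apply.
Qed.

Lemma polytope0_limit P x :
  (forall e : R, 0 < e -> exists2 y, (P : set _) y & enorm (x - y) < e) -> (P : set _) x.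
Proof.
move=> xP; apply: (polytope_closed (polytope0P P)).
rewrite closureEnbhs => A B AQ /nbhs_ballP[e /= e0 eB].
have [y Py xy] := xP _ e0; exists y; split; first exact: AQ.
exact/eB/ball_enorm.
Qed.

(** At the last parameter [u] for which the segment is in [P], the point is also a limit of points
    of [Q], or the endpoint [y]; both polytopes are closed. *)
Lemma polytope0_meet (P Q PQ : polytope0 R n) x y : PQ = (P : set _) `|` Q :> set _ ->
  (P : set _) x -> (Q : set _) y ->
  exists2 t : R, 0 <= t <= 1 & ((P : set _) `&` Q) ((1 - t) *: x + t *: y).
Proof.
move=> E Px Qy.
pose g (t : R) := (1 - t) *: x + t *: y.
have gL s t : enorm (g s - g t) = `|s - t| * enorm (y - x).
  by rewrite -enormZ; congr enorm; apply/rowP => i; rewrite /g !mxE; ring.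
have gPQ t : 0 <= t <= 1 -> (P : set _) (g t) \/ (Q : set _) (g t).
  move=> /andP[t0 t1]; have : (PQ : set _) (g t).
    apply: polytope0_convex; rewrite ?subr_ge0// ?subrK//; first by rewrite E; left.
    by rewrite E; right.
  by rewrite E.
pose S := [set t : R | 0 <= t <= 1 /\ (P : set _) (g t)].
have S0 : S 0 by split; rewrite /= ?lexx ?ler01// /g subr0 scale1r scale0r addr0.
have hS : has_sup S by split; [exists 0|exists 1 => t [/andP[]]].
pose u := sup S.
have u0 : 0 <= u by apply: sup_ubound => //; case: hS.
have u1 : u <= 1 by apply: ge_sup; [exists 0|move=> t [/andP[]]].
have enz (e : R) : 0 < e -> exists2 d : R, 0 < d & d * enorm (y - x) < e.
  move=> e0; exists (e / (enorm (y - x) + 1)).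
    by rewrite divr_gt0// ltr_wpDl// enorm_ge0.
  by rewrite mulrAC ltr_pdivrMr ?ltr_wpDl ?enorm_ge0// mulrDr mulr1 ltrDl.
have Pu : (P : set _) (g u).
  apply: polytope0_limit => e /enz[d d0 de].
  have [t [t01 Pt] ut] := sup_adherent d0 hS.
  exists (g t) => //; rewrite gL; apply: le_lt_trans de; rewrite ler_wpM2r ?enorm_ge0//.
  have tu : t <= u by apply: sup_ubound => //; case: hS.
  by rewrite ger0_norm ?subr_ge0//; move: ut; rewrite -/u; lra.
exists u; first by rewrite u0.
split=> //; have := u1; rewrite le_eqVlt => /orP[/eqP ->|u_lt1].
  by rewrite subrr scale0r add0r scale1r.
apply: polytope0_limit => e /enz[d d0 de].
pose t := Num.min 1 (u + d).
have ut : u < t by rewrite lt_min u_lt1 ltrDl.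
have t01 : 0 <= t <= 1 by rewrite (le_trans u0 (ltW ut)) ge_min lexx.
exists (g t).
  have [Pt|//] := gPQ t t01.
  by have : t <= u by [apply: sup_ubound; [case: hS|]]; rewrite leNgt ut.
rewrite -[X in X - _]/(g u) gL; apply: le_lt_trans de; rewrite ler_wpM2r ?enorm_ge0//.
by rewrite distrC ger0_norm ?subr_ge0 ?(ltW ut)// lerBlDl ge_min lexx orbT.
Qed.

Lemma ray_meet (P Q PQ : polytope0 R n) x y : PQ = (P : set _) `|` Q :> set _ ->
  ray P x -> ray Q y ->
  exists2 t : R, 0 <= t <= 1 & (ray P `&` ray Q) ((1 - t) *: x + t *: y).
Proof.
move=> E /ray_small[s s0 sx] /ray_small[t t0 ty].
have mn : 0 < Num.min s t by rewrite lt_min s0.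
have [||r r01 z] := @polytope0_meet P Q PQ (Num.min s t *: x) (Num.min s t *: y) E.
- by apply: sx; rewrite ge_min lexx (ltW mn).
- by apply: ty; rewrite ge_min lexx orbT (ltW mn).
exists r => //; move: z; rewrite !scalerA [_ * Num.min s t]mulrC [r * _]mulrC -!scalerA -scalerDr => -[Pz Qz].
by split; exists (Num.min s t).
Qed.

End RayCone.

(** * Dimension, relative interior and the valuation property *)

Section Dimension.
Context {R : realType} {n : nat}.
Implicit Types (P Q : polytope0 R n) (x y : 'rV[R]_n).

Lemma affine_hull_corner k (M : 'M[R]_(k, n)) :
  affine_hull (corner M) = [set u | u \in <<[tuple row i M | i < k]>>%VS].
Proof.
apply/seteqP; split=> [_ [m [a [x [a1 xM ->]]]]|u /coord_span ->].
  apply: rpred_sum => i _; apply: rpredZ; have [c [_ _ ->]] := xM i.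
  apply: rpred_sum => j _; apply: rpredZ; apply: memv_span.
  by apply/tnthP; exists j; rewrite tnth_mktuple.
set X := [tuple row i M | i < k].
exists k.+1, (fun i => oapp (fun i => coord X i u) (1 - \sum_i coord X i u) (unlift ord0 i)),
  (fun i => oapp (fun i => row i M) 0 (unlift ord0 i)); split.
- rewrite big_ord_recl unlift_none/= [X in _ + X](_ : _ = \sum_i coord X i u) ?subrK//.
  by apply: eq_bigr => i _; rewrite liftK.
- move=> i; case: (unliftP ord0 i) => [j|] _ /=; last exact: fcorner0.
  exact: (fcorner_vertex (fun i => row i M)).
- rewrite big_ord_recl unlift_none/= scaler0 add0r; apply: eq_bigr => i _.
  by rewrite liftK; congr (_ *: _); rewrite (nth_map i) ?size_enum_ord// nth_ord_enum.
Qed.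

(** [affine_dim] chooses some direction space, so uniqueness is needed: a translate [x + U'] that is
    a subspace equals [U']. *)
Lemma affine_dimE (A : set 'rV[R]_n) (U : {vspace 'rV[R]_n}) :
  affine_hull A = [set u | u \in U] -> affine_dim A = \dim U.
Proof.
move=> AU; rewrite /affine_dim.
have [|x [U' [AU' ->]]] := @getPex _ [set d | exists (x : 'rV[R]_n) (U : {vspace 'rV[R]_n}),
    affine_hull A = [set x + u | u in [set u | u \in U]] /\ d = \dim U].
  exists (\dim U), 0, U; split=> //; rewrite AU; apply/seteqP; split=> y.
    by move=> yU; exists y; rewrite ?add0r.
  by move=> [u uU <-]; rewrite add0r.
congr (\dim _); apply/vspaceP => y.
have memE z : (z \in U) <-> exists2 u, u \in U' & x + u = z.
  have := congr1 (fun S : set _ => S z) AU'; rewrite AU /= => ->.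
  by split=> -[u]; exists u.
have [u0 u0U' xu0] : exists2 u, u \in U' & x + u = 0 by apply/memE; exact: mem0v.
have xU' : x \in U'.
  have -> : x = - u0 by apply/eqP; rewrite -addr_eq0 xu0.
  by rewrite rpredN.
apply/idP/idP => [yU'|/memE[u uU' <-]]; last exact: rpredD.
apply/memE; exists (y - x); first exact: rpredB.
by rewrite addrC subrK.
Qed.

Lemma affine_hull_polytope0 P : exists U : {vspace 'rV[R]_n},
  affine_hull P = [set u | u \in U] /\ affine_dim P = \dim U.
Proof.
have [k [M PM]] := polytope0_corner P.
have AU := affine_hull_corner M; rewrite -PM in AU.
by eexists; split; [exact: AU|exact: affine_dimE].
Qed.

Lemma sub_affine_hull (A : set 'rV[R]_n) : A `<=` affine_hull A.
Proof.
move=> x Ax; exists 1%N, (fun=> 1), (fun=> x); split=> //.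
  by rewrite big_ord1.
by rewrite big_ord1 scale1r.
Qed.

Lemma ccone_sum (C : set 'rV[R]_n) (I : finType) (a : I -> R) (x : I -> 'rV[R]_n) :
  ccone C -> (forall i, 0 <= a i) -> (forall i, C (x i)) -> C (\sum_i a i *: x i).
Proof.
move=> [C0 CD CZ] a0 xC; elim/big_ind : _ => // i _.
by have := a0 i; rewrite le_eqVlt => /orP[/eqP <-|ai]; [rewrite scale0r|exact: CZ].
Qed.

(** Symmetry moves the sign of a coefficient onto its point, which makes an affine combination a
    conical one. *)
Lemma ray_sym_hull P : csym (ray P) -> ray P = affine_hull P.
Proof.
move=> sP; have cP := ray_ccone P; have [_ _ CZ] := cP.
have [U [PU _]] := affine_hull_polytope0 P.
apply/seteqP; split=> [x [t t0 Px]|_ [k [a [x [_ xP ->]]]]].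
  have := sub_affine_hull Px; rewrite PU /= => xU.
  by rewrite -(scale1r x) -(mulVf (lt0r_neq0 t0)) -scalerA; exact: rpredZ.
rewrite (eq_bigr (fun i => `|a i| *: ((-1) ^+ (a i < 0)%R *: x i))) => [|i _].
  apply: ccone_sum => // i; have := ray_sub (xP i).
  by case: (_ < _); rewrite ?expr0 ?scale1r// expr1 scaleN1r; exact: sP.
by rewrite scalerA mulrC -realEsign// num_real.
Qed.

Lemma ray_sym_vspace P : csym (ray P) ->
  exists U : {vspace 'rV[R]_n}, ray P = [set u | u \in U] /\ affine_dim P = \dim U.
Proof. by move=> /ray_sym_hull ->; exact: affine_hull_polytope0. Qed.

(* A subspace spanned as a cone by [P] has a basis with multiples +-t b_i in [P],
   hence a neighborhood of 0 in [P]. *)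
Lemma relint_sym P : relint P 0 <-> csym (ray P).
Proof.
have [U [PU _]] := affine_hull_polytope0 P.
split=> [[_ /nbhs_ballP[e /= e0 eP]] x [t t0 Px]|sP].
  pose s := e / (enorm (t *: x) + 1).
  have s0 : 0 < s by rewrite divr_gt0// ltr_wpDl// enorm_ge0.
  exists (s * t); first exact: mulr_gt0.
  rewrite scalerN -scalerA -scaleNr; apply: eP.
    apply: ball_enorm; rewrite sub0r enormN enormZ normrN gtr0_norm//.
    by rewrite mulrAC ltr_pdivrMr ?ltr_wpDl ?enorm_ge0// mulrDr mulr1 ltrDl.
  have := sub_affine_hull Px; rewrite PU /= => xU; exact: rpredZ.
split; first by apply: sub_affine_hull; exact: polytope0_0.
have [U' [rU _]] := ray_sym_vspace sP.
have {U' rU} rU : ray P = [set u | u \in U] by rewrite ray_sym_hull.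
pose b := vbasis U.
have /choice[t tP] i : exists t : R, 0 < t /\ forall k : bool, (P : set _) ((-1) ^+ k *: (t *: tnth b i)).
  have bU : ray P (tnth b i) by rewrite rU; exact: vbasis_mem (mem_tnth _ _).
  have [s s0 sb] := ray_small bU; have [r r0 rb] := ray_small (sP _ bU).
  have mn : 0 < Num.min s r by rewrite lt_min s0.
  exists (Num.min s r); split=> // -[]; rewrite ?expr0 ?scale1r ?expr1 ?scaleN1r -?scalerN.
    by apply: rb; rewrite ge_min lexx orbT (ltW mn).
  by apply: sb; rewrite ge_min lexx (ltW mn).
(* [S i] bounds the [i]-th coordinate in the sup norm, so in the ball of radius [(T + 1)^-1] the
   weights of the points [t i *: tnth b i], up to sign, sum to at most 1. *)
pose S i := \sum_j `|coord b i (delta_mx 0 j)|.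
have S0 i : 0 <= S i by exact: sumr_ge0.
have t0 i : 0 < t i by have [] := tP i.
pose T := \sum_i S i / t i.
have T0 : 0 <= T by apply: sumr_ge0 => i _; rewrite divr_ge0// ltW.
apply/nbhs_ballP; exists (T + 1)^-1 => /=; first by rewrite invr_gt0 ltr_wpDl.
move=> y [_ y0]; rewrite PU /= => yU.
have yS i : `|coord b i y| <= (T + 1)^-1 * S i.
  rewrite {1}[y]row_sum_delta linear_sum/= (le_trans (ler_norm_sum _ _ _))//.
  rewrite mulr_sumr; apply: ler_sum => j _; rewrite linearZ/= normrM ler_wpM2r//.
  by have := y0 0 j; rewrite /ball/= !mxE sub0r normrN => /ltW.
have [k [M PM]] := polytope0_corner P.
rewrite (coord_vbasis yU) (eq_bigr (fun i => (`|coord b i y| / t i) *: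
    ((-1) ^+ (coord b i y < 0)%R *: (t i *: tnth b i)))) => [|i _]; last first.
  rewrite !scalerA -tnth_nth; congr (_ *: _).
  by rewrite mulrAC divfK ?gt_eqF// mulrC -realEsign// num_real.
rewrite PM; apply: fcorner_sum => [i||i].
- by rewrite divr_ge0// ltW.
- apply: (@le_trans _ _ (\sum_i (T + 1)^-1 * (S i / t i))).
    by apply: ler_sum => i _; rewrite mulrA ler_pM2r ?invr_gt0.
  by rewrite -mulr_sumr -/T mulrC ler_pdivrMr ?mul1r ?lerDl// ltr_wpDl.
- by rewrite -/(corner M) -PM; have [_] := tP i; apply.
Qed.

Definition omega P : R := (-1) ^+ affine_dim P * \1_(relint P) (0 : 'rV[R]_n).

Lemma omega_sym P : csym (ray P) -> omega P = (-1) ^+ affine_dim P.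
Proof. by move=> /relint_sym P0; rewrite /omega indicE mem_set ?mulr1. Qed.

Lemma omega_nsym P : ~ csym (ray P) -> omega P = 0.
Proof. by move=> nP; rewrite /omega indicE memNset ?mulr0// => /relint_sym. Qed.

Lemma omega_eq P Q : ray P = ray Q -> omega P = omega Q.
Proof.
move=> PQ; have [sP|nP] := pselect (csym (ray P)); last by rewrite !omega_nsym// -PQ.
have sQ : csym (ray Q) by rewrite -PQ.
rewrite !omega_sym//; have [U [PU ->]] := ray_sym_vspace sP.
have [U' [QU' ->]] := ray_sym_vspace sQ; congr (_ ^+ \dim _).
apply/vspaceP => u; have := congr1 (fun S : set _ => S u) PQ; rewrite PU QU' /= => UU'.
by apply/idP/idP; rewrite UU'.
Qed.

(* When two proper cones cover a subspace, they are complementary halfspaces. *)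
Lemma omega_cover P Q (PQ PnQ : polytope0 R n) x0 y0 :
  PQ = (P : set _) `|` Q :> set _ -> PnQ = (P : set _) `&` Q :> set _ ->
  csym (ray PQ) -> ray P x0 -> ~ ray Q x0 -> ray Q y0 -> ~ ray P y0 ->
  omega P + omega Q = omega PQ + omega PnQ.
Proof.
move=> E F sPQ Px0 nQx0 Qy0 nPy0.
have EQP : PQ = (Q : set _) `|` P :> set _ by rewrite E setUC.
have cU := ray_ccone PQ; rewrite (rayU E) in cU.
have cU' := cU; rewrite setUC in cU'.
have sU := sPQ; rewrite (rayU E) in sU; have sU' := sU; rewrite setUC in sU'.
have nP : ~ csym (ray P) := cover_nsym (ray_ccone P) (ray_ccone Q) cU sU Px0 nQx0 Qy0 nPy0.
have nQ : ~ csym (ray Q) := cover_nsym (ray_ccone Q) (ray_ccone P) cU' sU' Qy0 nPy0 Px0 nQx0.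
have meet x y := @ray_meet _ _ P Q PQ x y E.
have sI : csym (ray PnQ).
  by rewrite (rayI F); exact: (cover_sym_meet (ray_ccone P) (ray_ccone Q) meet sU Px0 nQx0 Qy0 nPy0).
have codim := cover_codim1 (ray_ccone P) (ray_ccone Q) meet sU Px0 nQx0 Qy0 nPy0.
rewrite (omega_nsym nP) (omega_nsym nQ) addr0 !omega_sym//.
have [L [PQL ->]] := ray_sym_vspace sPQ; have [S [IS ->]] := ray_sym_vspace sI.
rewrite (rayU E) in PQL; rewrite (rayI F) in IS.
have memL w : w \in L <-> (ray P `|` ray Q) w by rewrite PQL.
have memS w : w \in S <-> (ray P `&` ray Q) w by rewrite IS.
(* By [cover_codim1] the intersection has codimension 1, so the two signs on the right cancel. *)
have LE : L = (S + <[x0]>)%VS.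
  apply/vspaceP => w; apply/idP/memv_addP => [/memL/codim[r /memS z]|[u /memS[Pu _] [_ /vlineP[r ->] ->]]].
    by exists (w - r *: x0) => //; exists (r *: x0); rewrite ?subrK// memvZ// memv_line.
  by apply: rpredD; [apply/memL; left|apply: rpredZ; apply/memL; left].
have x0S : x0 \notin S by apply/negP => /memS[].
have -> : \dim L = (\dim S).+1.
  have x0_neq0 : x0 != 0 by apply: contraNneq x0S => ->; exact: mem0v.
  rewrite LE dimv_disjoint_sum ?dim_vline ?x0_neq0 ?addn1//.
  apply/eqP; rewrite -subv0; apply/subvP => w; rewrite memv_cap => /andP[wS /vlineP[r wr]].
  have [r0|r0] := eqVneq r 0; first by rewrite wr r0 scale0r mem0v.
  case/negP: x0S; have -> : x0 = r^-1 *: w by rewrite wr scalerA mulVf ?scale1r.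
  exact: memvZ.
by rewrite exprS mulN1r addNr.
Qed.

(** Nested cones merely permute the terms. Otherwise neither cone is a subspace, by
    [cone_sub_of_sym], and either the union is one, as in [omega_cover], or all four terms vanish by
    [meet_nsym]. *)
Lemma omega_valuation : valuation omega.
Proof.
move=> P Q PQ PnQ E F.
have RU := rayU E; have RI := rayI F.
have meet x y := @ray_meet _ _ P Q PQ x y E.
have EQP : PQ = (Q : set _) `|` P :> set _ by rewrite E setUC.
have meet' x y := @ray_meet _ _ Q P PQ x y EQP.
have sub1 : ray Q `<=` ray P -> omega P + omega Q = omega PQ + omega PnQ.
  move=> QP; congr (_ + _); apply: omega_eq.
    by rewrite RU; apply/esym/setUidPl.
  by rewrite RI; apply/esym/setIidPr.
have sub2 : ray P `<=` ray Q -> omega P + omega Q = omega PQ + omega PnQ.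
  move=> PQ'; rewrite addrC; congr (_ + _); apply: omega_eq.
    by rewrite RU; apply/esym/setUidPr.
  by rewrite RI; apply/esym/setIidPl.
have [sPQ|nPQ'] := pselect (ray P `<=` ray Q); first exact: sub2.
have [sQP|nQP'] := pselect (ray Q `<=` ray P); first exact: sub1.
have [sP|nP] := pselect (csym (ray P)).
  by apply: sub2; exact: (cone_sub_of_sym (ray_ccone P) meet sP nQP').
have [sQ|nQ] := pselect (csym (ray Q)).
  by apply: sub1; exact: (cone_sub_of_sym (ray_ccone Q) meet' sQ nPQ').
have [sU|nU] := pselect (csym (ray PQ)).
  have /existsNP[x0 /not_implyP[Px0 nQx0]] := nPQ'.
  have /existsNP[y0 /not_implyP[Qy0 nPy0]] := nQP'.
  exact: (omega_cover E F sU Px0 nQx0 Qy0 nPy0).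
have nI : ~ csym (ray PnQ).
  rewrite RI; apply: (meet_nsym (ray_ccone P) (ray_ccone Q) meet) => //.
  by rewrite -RU.
by rewrite !omega_nsym.
Qed.

End Dimension.

(** * Invariance and measurability of the sign functional *)

Section OmegaInvariance.
Context {R : realType} {n : nat}.
Implicit Types (P Q : polytope0 R n) (x y : 'rV[R]_n).

Lemma ray_image (A : 'M[R]_n) P : A \in unitmx ->
  ray (polytope0_image A P) = [set x | ray P (x *m invmx A^T)].
Proof.
move=> uA; have uAt : A^T \in unitmx by rewrite unitmx_tr.
apply/seteqP; split=> x.
  move=> [t t0 [y Py yE]]; exists t => //.
  by rewrite scalemxAl -yE mulmxK.
move=> [t t0 xt]; exists t => //; exists (t *: (x *m invmx A^T)) => //.
by rewrite scalemxAl mulmxKV.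
Qed.

Lemma omega_SL : sl_invariant (@omega R n).
Proof.
move=> A detA P.
have uA : A \in unitmx by rewrite unitmxE detA unitr1.
have uAt : A^T \in unitmx by rewrite unitmx_tr.
have rE := ray_image P uA.
have symE : csym (ray (polytope0_image A P)) <-> csym (ray P).
  rewrite rE; split=> sP x /= Px; last by rewrite mulNmx; exact: sP.
  have := sP (x *m A^T); rewrite /= mulNmx mulmxK//; exact.
have [sP|nP] := pselect (csym (ray P)); last first.
  by rewrite !omega_nsym// => /symE.
have sAP : csym (ray (polytope0_image A P)) by apply/symE.
rewrite !omega_sym//; congr (_ ^+ _).
have [U [PU ->]] := ray_sym_vspace sP; have [U' [PU' ->]] := ray_sym_vspace sAP.
pose f : 'End('rV[R]_n) := linfun (mulmxr A^T).
have fE x : f x = x *m A^T by rewrite lfunE.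
have -> : U' = (f @: U)%VS.
  have U'E x : (x \in U') <-> (x *m invmx A^T \in U).
    have := congr1 (fun S : set _ => S x) rE; rewrite PU' PU /= => ->.
    by [].
  apply/vspaceP => x; apply/idP/memv_imgP => [/U'E xU|[u uU ->]].
    by exists (x *m invmx A^T) => //; rewrite fE mulmxKV.
  by apply/U'E; rewrite fE mulmxK.
rewrite limg_dim_eq//; apply/eqP; rewrite -subv0; apply/subvP => u.
rewrite memv_cap => /andP[_]; rewrite memv_ker fE => /eqP u0.
by rewrite -(mulmxK uAt u) u0 mul0mx mem0v.
Qed.

Notation bT := (g_sigma_algebraType (@open (polytope0 R n))).

(** One factor serves the finitely many vertices and hence all points; symmetry becomes a countable
    union of closed conditions. *)
Lemma sym_uniform P : csym (ray P) ->
  exists m : nat, forall x, (P : set _) x -> (P : set _) (- m.+1%:R^-1 *: x).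
Proof.
move=> sP; have [k [M PM]] := polytope0_corner P.
have rowP i : (P : set _) (row i M) by rewrite PM; exact: (fcorner_vertex (fun i => row i M)).
have /choice[t tP] i : exists t : R, 0 < t /\ forall s, 0 <= s <= t -> (P : set _) (s *: - row i M).
  by have [t t0 ?] := ray_small (sP _ (ray_sub (rowP i))); exists t.
pose N := Num.bound (\sum_i (t i)^-1).
exists N => x; rewrite PM => -[a [a0 a1 ->]].
rewrite scaler_sumr (eq_bigr (fun i => a i *: (- N.+1%:R^-1 *: row i M))) => [|i _]; last first.
  by rewrite !scalerA mulrC.
apply: fcorner_sum => // i; rewrite -/(corner M) -PM scaleNr -scalerN.
have [ti0 tiP] := tP i; apply: tiP; rewrite invr_ge0 ler0n/=.
rewrite -[leRHS]invrK lef_pV2 ?posrE ?invr_gt0//.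
have tinv0 j : 0 <= (t j)^-1 by rewrite invr_ge0 ltW//; have [] := tP j.
apply: (@le_trans _ _ (\sum_i (t i)^-1)).
  by rewrite (bigD1 i)//= lerDl sumr_ge0.
apply: ltW; apply: lt_le_trans (archi_boundP _) _; first exact: sumr_ge0.
by rewrite ler_nat.
Qed.

Lemma measurable_sym : measurable [set P : bT | csym (ray (P : polytope0 R n))].
Proof.
have -> : [set P : bT | csym (ray (P : polytope0 R n))] = \bigcup_m [set P : bT |
    forall x, (P : set _) x -> (P : set _) (- m.+1%:R^-1 *: x)].
  apply/seteqP; split=> P; first by move=> /sym_uniform[m mP]; exists m.
  move=> [m _ mP] x [t t0 Px]; exists (m.+1%:R^-1 * t); first by rewrite mulr_gt0.
  by rewrite scalerN -scalerA -scaleNr; exact: mP.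
apply: bigcupT_measurable => m; rewrite -[X in measurable X]setCK.
apply: measurableC; apply: sub_sigma_algebra.
apply: polytope0_openP => P /existsNP[x /not_implyP[Px nPx]].
set c := m.+1%:R^-1 in nPx *.
have c0 : 0 <= c by rewrite invr_ge0.
have c1 : c <= 1 by rewrite invf_le1// ler1n.
have [e e0 eP] : exists2 e : R, 0 < e & forall y, (P : set _) y -> e <= enorm (- c *: x - y).
  apply: contrapT => ne; apply: nPx; apply: polytope0_limit => e e0.
  apply: contrapT => ny; apply: ne; exists e => // y Py; rewrite leNgt; apply/negP => ye.
  by apply: ny; exists y.
(* The scaling by [c <= 1] and the passage back from [Q] to [P] each cost at most [e / 4], leaving
   less than the distance [e]. *)
exists (e / 4); first by rewrite divr_gt0.
move=> Q /ball_polytope0[PQ QP] /= Qc.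
have [x' Qx' xx'] := PQ _ Px; have [y Py yx'] := QP _ (Qc _ Qx').
have := eP _ Py; apply/negP; rewrite -ltNge.
apply: le_lt_trans (enormB_trans (- c *: x') _ _) _.
rewrite -scalerBr enormZ normrN ger0_norm// [X in _ + X]enormC.
have : c * enorm (x - x') <= 1 * (e / 4) by apply: ler_pM; rewrite ?enorm_ge0.
move: yx'; lra.
Qed.

(** As [P] contains 0, this means dimension at least [k], in a form that is visibly stable under
    perturbation. *)
Definition indep_points k P := exists M : 'M[R]_(k, n), row_free M /\ forall i, (P : set _) (row i M).

Lemma indep_points_le k P : indep_points k P -> (k <= affine_dim P)%N.
Proof.
move=> [M [Mfree MP]]; have [U [PU ->]] := affine_hull_polytope0 P.
pose X := [tuple row i M | i < k].
have Xi (i : 'I_k) : X`_i = row i M by rewrite -tnth_nth tnth_mktuple.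
suff : free X.
  rewrite /free size_tuple => /eqP <-; apply: dimvS; apply/span_subvP => _ /tnthP[i ->].
  by rewrite tnth_mktuple; have := sub_affine_hull (MP i); rewrite PU.
apply/freeP => c; rewrite (eq_bigr (fun i => (\row_i c i) 0 i *: row i M)) => [|i _]; last first.
  by rewrite mxE Xi.
rewrite -mulmx_sum_row => /eqP; rewrite mulmx_free_eq0// => /eqP c0 i.
by have := congr1 (fun v : 'rV[R]_k => v 0 i) c0; rewrite !mxE.
Qed.

Lemma indep_points_dim P : indep_points (affine_dim P) P.
Proof.
have [k [M PM]] := polytope0_corner P.
pose N := rowsub (maxrankfun M) M.
have Nfree : row_free N := maxrowsub_free M.
have rowN i : row i N = row (maxrankfun M i) M by apply/rowP => j; rewrite !mxE.
have NP : indep_points (\rank M) P.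
  by exists N; split=> // i; rewrite rowN PM; exact: (fcorner_vertex (fun i => row i M)).
suff <- : \rank M = affine_dim P by [].
apply/eqP; rewrite eqn_leq indep_points_le//=.
rewrite PM (affine_dimE (affine_hull_corner M)).
apply: leq_trans (_ : \dim <<[tuple row i N | i < \rank M]>> <= _)%N.
  apply: dimvS; apply/span_subvP => _ /tnthP[i ->]; rewrite tnth_mktuple.
  have : (row i M <= N)%MS by rewrite eq_maxrowsub row_sub.
  move=> /submxP[w ->]; rewrite mulmx_sum_row; apply: rpred_sum => j _; apply: rpredZ.
  by apply: memv_span; apply/tnthP; exists j; rewrite tnth_mktuple.
by apply: leq_trans (dim_span _) _; rewrite size_tuple.
Qed.

(** With a right inverse [B] of [M], a relation [v] among the perturbed rows is [v] times the
    perturbation times [B]; its l1 norm is at most [C / (C + 1)] times itself, so [v = 0]. *)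
Lemma open_indep_points k : open [set P : polytope0 R n | indep_points k P].
Proof.
apply: polytope0_openP => P [M [/row_freeP[B MB] MP]].
pose C := \sum_j enorm (col j B)^T.
have C0 : 0 <= C by apply: sumr_ge0 => j _; exact: enorm_ge0.
exists (C + 1)^-1; first by rewrite invr_gt0 ltr_wpDl.
move=> Q /ball_polytope0[PQ _].
have /choice[q qP] i : exists y, (Q : set _) y /\ enorm (row i M - y) <= (C + 1)^-1.
  by have [y Qy My] := PQ _ (MP i); exists y.
exists (\matrix_i q i); split=> [|i]; last by rewrite rowK; have [] := qP i.
rewrite -kermx_eq0; apply/rowV0P => v /sub_kermxP vq.
pose S := \sum_i `|v 0 i|.
have S0 : 0 <= S by exact: sumr_ge0.
have vj j : `|v 0 j| <= S * ((C + 1)^-1 * enorm (col j B)^T).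
  have -> : v 0 j = \sum_i v 0 i * dot (row i M - q i) (col j B).
    have -> : v 0 j = dot (v *m M) (col j B).
      by rewrite /dot colE mulmxA -(mulmxA v) MB mulmx1 -colE mxE.
    transitivity (dot (v *m M) (col j B) - dot (v *m \matrix_i q i) (col j B)).
      by rewrite vq dot0l subr0.
    rewrite !mulmx_sum_row !dot_suml -sumrB.
    by apply: eq_bigr => i _; rewrite rowK dotDl dotNl mulrBr.
  rewrite (le_trans (ler_norm_sum _ _ _))// /S mulr_suml; apply: ler_sum => i _.
  rewrite normrM ler_wpM2l//; apply: le_trans (norm_dot_le _ _) _.
  by rewrite ler_wpM2r ?enorm_ge0//; have [] := qP i.
have SE : S <= S * ((C + 1)^-1 * C).
  by rewrite /C !mulr_sumr; apply: ler_sum => j _; exact: vj.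
have {SE} S_eq0 : S = 0.
  apply/eqP; rewrite eq_le S0 andbT leNgt; apply/negP => Sgt0.
  move: SE; rewrite -[X in X <= _]mulr1 ler_pM2l// leNgt => /negP; apply.
  by rewrite mulrC ltr_pdivrMr ?ltr_wpDl// mul1r ltrDl.
apply/rowP => j; rewrite mxE; apply/eqP; rewrite -normr_le0.
by apply: le_trans (vj j) _; rewrite S_eq0 mul0r.
Qed.

Lemma measurable_dim k : measurable [set P : bT | affine_dim (P : polytope0 R n) = k].
Proof.
have -> : [set P : bT | affine_dim (P : polytope0 R n) = k] =
    [set P : bT | indep_points k P] `\` \bigcup_j [set P : bT | indep_points (k.+1 + j) P].
  apply/seteqP; split=> P /=.
    move=> <-; split; first exact: indep_points_dim.
    by move=> [j _ /indep_points_le]; rewrite leqNgt addSn ltnS leq_addr.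
  move=> [/indep_points_le kP nP]; apply/eqP; rewrite eqn_leq kP andbT leqNgt; apply/negP => kP'.
  apply: nP; exists (affine_dim P - k.+1)%N => //=; rewrite subnKC//; exact: indep_points_dim.
apply: measurableD; first by apply: sub_sigma_algebra; exact: open_indep_points.
apply: bigcupT_measurable => j; apply: sub_sigma_algebra; exact: open_indep_points.
Qed.

Lemma omega_borel : borel_measurable (@omega R n).
Proof.
apply/borel_measurableP.
have -> : @omega R n = (fun P : bT => \1_[set P : bT | csym (ray (P : polytope0 R n))] P * (-1) ^+ affine_dim P).
  apply/funext => P; have [sP|nP] := pselect (csym (ray P)).
    by rewrite omega_sym// indicE mem_set// mul1r.
  by rewrite omega_nsym// indicE memNset// mul0r.
apply: measurable_funM; first by apply: measurable_indic; exact: measurable_sym.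
move=> _ Y mY; rewrite setTI.
have -> : (fun P : bT => (-1) ^+ affine_dim P : R) @^-1` Y =
    \bigcup_(k in [set k | Y ((-1) ^+ k)]) [set P : bT | affine_dim P = k].
  apply/seteqP; split=> P /=; first by move=> YP; exists (affine_dim P).
  by move=> [k Yk /= ->].
by apply: bigcup_measurable => k _; exact: measurable_dim.
Qed.

End OmegaInvariance.

(** * Classification *)

Section SimplexCut.
Context {R : realType} {n : nat}.
Implicit Types (u v w x : 'rV[R]_n).

Lemma corner_colP k u (N : 'M[R]_(k, n)) x : corner (col_mx u N) x <->
  exists a : R, exists c : 'rV[R]_k,
    [/\ 0 <= a, forall i, 0 <= c 0 i, a + \sum_i c 0 i <= 1 & x = a *: u + c *m N].
Proof.
split=> [/cornerP[a [a0 a1 ->]]|[a [c [a0 c0 ac ->]]]].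
  exists (lsubmx a 0 0), (rsubmx a); split.
  - by rewrite mxE.
  - by move=> i; rewrite mxE.
  - rewrite big_split_ord big_ord1/= in a1; rewrite mxE (eq_bigr (fun i => a 0 (rshift 1 i)))//.
    by move=> i _; rewrite mxE.
  - by rewrite -{1}[a]hsubmxK mul_row_col {1}[lsubmx a]mx11_scalar mul_scalar_mx.
apply/cornerP; exists (row_mx a%:M c); split.
- move=> i; case: (split_ordP i) => j ->; first by rewrite row_mxEl ord1 mxE eqxx mulr1n.
  by rewrite row_mxEr.
- rewrite big_split_ord big_ord1/= row_mxEl mxE eqxx mulr1n.
  by under eq_bigr do rewrite row_mxEr.
- by rewrite mul_row_col mul_scalar_mx.
Qed.

Lemma corner_col2P k u v (N : 'M[R]_(k, n)) x : corner (col_mx u (col_mx v N)) x <->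
  exists a b : R, exists c : 'rV[R]_k,
    [/\ 0 <= a, 0 <= b, forall i, 0 <= c 0 i, a + b + \sum_i c 0 i <= 1 &
        x = a *: u + b *: v + c *m N].
Proof.
split=> [/corner_colP[a [d [a0 d0 ad ->]]]|[a [b [c [a0 b0 c0 abc ->]]]]].
  exists a, (lsubmx d 0 0), (rsubmx d); split=> //.
  - by rewrite mxE.
  - by move=> i; rewrite mxE.
  - rewrite big_split_ord big_ord1/= in ad; rewrite mxE (eq_bigr (fun i => d 0 (rshift 1 i))).
      by rewrite -addrA.
    by move=> i _; rewrite mxE.
  - by rewrite -{1}[d]hsubmxK mul_row_col {1}[lsubmx d]mx11_scalar mul_scalar_mx addrA.
apply/corner_colP; exists a, (row_mx b%:M c); split=> //.
- move=> i; case: (split_ordP i) => j ->; first by rewrite row_mxEl ord1 mxE eqxx mulr1n.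
  by rewrite row_mxEr.
- rewrite big_split_ord big_ord1/= row_mxEl mxE eqxx mulr1n addrA.
  by under eq_bigr do rewrite row_mxEr.
- by rewrite mul_row_col mul_scalar_mx addrA.
Qed.

Lemma col2_inj k u v (N : 'M[R]_(k, n)) (a b a' b' : R) (c c' : 'rV[R]_k) :
  row_free (col_mx u (col_mx v N)) ->
  a *: u + b *: v + c *m N = a' *: u + b' *: v + c' *m N -> [/\ a = a', b = b' & c = c'].
Proof.
have E (s t : R) (d : 'rV_k) : s *: u + t *: v + d *m N =
    row_mx s%:M (row_mx t%:M d) *m col_mx u (col_mx v N).
  by rewrite !mul_row_col !mul_scalar_mx addrA.
move=> free; rewrite !E => /(row_free_inj free)/eq_row_mx[+ /eq_row_mx[+ ->]].
move=> /(congr1 (fun A : 'M[R]_1 => A 0 0)) + /(congr1 (fun A : 'M[R]_1 => A 0 0)).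
by rewrite !mxE eqxx !mulr1n.
Qed.

Lemma row_free_unitl m (E : 'M[R]_m) (M : 'M[R]_(m, n)) : E \in unitmx -> row_free M -> row_free (E *m M).
Proof.
move=> uE /row_freeP[B MB]; apply/row_freeP; exists (B *m invmx E).
by rewrite mulmxA -(mulmxA E) MB mulmx1 mulmxV.
Qed.

Lemma row_free_dsub m (y : 'rV[R]_n) (M : 'M[R]_(m, n)) : row_free (col_mx y M) -> row_free M.
Proof.
move=> yM; rewrite -kermx_eq0; apply/rowV0P => z /sub_kermxP zM.
have : row_mx (0 : 'M[R]_1) z *m col_mx y M = 0 *m col_mx y M.
  by rewrite mul_row_col !mul0mx zM addr0.
by move=> /(row_free_inj yM); rewrite -[0 in RHS]row_mx0 => /eq_row_mx[_].
Qed.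

Variables (k : nat) (u v : 'rV[R]_n) (N : 'M[R]_(k, n)) (al : R).
Hypothesis al01 : 0 < al < 1.
Hypothesis free : row_free (col_mx u (col_mx v N)).
Let w := al *: u + (1 - al) *: v.

Let al0 : 0 < al. Proof. by case/andP: al01. Qed.
Let al1 : 0 < 1 - al. Proof. by case/andP: al01 => _; rewrite subr_gt0. Qed.

(** The sign of [al * b - (1 - al) * a] tells on which side of [w] the part [a *: u + b *: v] lies;
    replacing [u] or [v] by the affine combination [w] keeps the total weight. *)
Lemma corner_cutU : corner (col_mx u (col_mx v N)) =
  corner (col_mx u (col_mx w N)) `|` corner (col_mx w (col_mx v N)).
Proof.
apply/seteqP; split=> x.
  move=> /corner_col2P[a [b [c [a0 b0 c0 abc ->]]]].
  have [ab|/ltW ab] := leP (al * b) ((1 - al) * a).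
    left; apply/corner_col2P; exists (a - al * (b / (1 - al))), (b / (1 - al)), c; split=> //.
    - rewrite subr_ge0 mulrA ler_pdivrMr// [a * _]mulrC//.
    - by rewrite divr_ge0// ltW.
    - apply: le_trans abc; rewrite lerD2r le_eqVlt; apply/orP; left; apply/eqP.
      by field; rewrite gt_eqF.
    - congr (_ + _); rewrite /w scalerDr !scalerA divfK ?gt_eqF// scalerBl addrA.
      by rewrite [_ / _ * al]mulrC subrK.
  right; apply/corner_col2P; exists (a / al), (b - (1 - al) * (a / al)), c; split=> //.
  - by rewrite divr_ge0// ltW.
  - by rewrite subr_ge0 mulrA ler_pdivrMr// [b * _]mulrC.
  - apply: le_trans abc; rewrite lerD2r le_eqVlt; apply/orP; left; apply/eqP.
    by field; rewrite gt_eqF.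
  - congr (_ + _); rewrite /w scalerDr !scalerA divfK ?gt_eqF// scalerBl -addrA; congr (_ + _).
    by rewrite [_ / _ * (1 - al)]mulrC addrC subrK.
move=> [] /corner_col2P[a [b [c [a0 b0 c0 abc ->]]]]; apply/corner_col2P.
  exists (a + b * al), (b * (1 - al)), c; split=> //.
  - by rewrite addr_ge0// mulr_ge0// ltW.
  - by rewrite mulr_ge0// ltW.
  - by apply: le_trans abc; rewrite lerD2r le_eqVlt; apply/orP; left; apply/eqP; ring.
  - by rewrite /w scalerDr !scalerA scalerDl addrA.
exists (a * al), (a * (1 - al) + b), c; split=> //.
- by rewrite mulr_ge0// ltW.
- by rewrite addr_ge0// mulr_ge0// ltW.
- by apply: le_trans abc; rewrite lerD2r le_eqVlt; apply/orP; left; apply/eqP; ring.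
- by rewrite /w scalerDr !scalerA scalerDl addrA.
Qed.

Lemma corner_cutI : corner (col_mx w N) =
  corner (col_mx u (col_mx w N)) `&` corner (col_mx w (col_mx v N)).
Proof.
apply/seteqP; split=> x.
  move=> /corner_colP[a [c [a0 c0 ac ->]]]; split; apply/corner_col2P.
    by exists 0, a, c; split; rewrite ?add0r// scale0r add0r.
  by exists a, 0, c; split; rewrite ?addr0// scale0r addr0.
move=> [/corner_col2P[a [b [c [a0 b0 c0 abc xE]]]] /corner_col2P[a' [b' [c' [a0' b0' c0' abc' xE']]]]].
have : (a + b * al) *: u + (b * (1 - al)) *: v + c *m N =
    (a' * al) *: u + (a' * (1 - al) + b') *: v + c' *m N.
  transitivity x; [rewrite xE|rewrite xE']; rewrite /w scalerDr !scalerA scalerDl !addrA//.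
move=> /(col2_inj free)[e1 e2 _].
have a_eq0 : a = 0.
  apply/eqP; rewrite eq_le a0 andbT.
  have : a' <= b by rewrite -(ler_pM2r al1) e2 lerDl.
  rewrite -(ler_pM2r al0); lra.
apply/corner_colP; exists b, c; split=> //; first by move: abc; rewrite a_eq0 add0r.
by rewrite xE a_eq0 scale0r add0r.
Qed.

Lemma corner_cut_valuation (Psi : polytope0 R n -> R) : valuation Psi ->
  Psi (corner_poly (col_mx u (col_mx w N))) + Psi (corner_poly (col_mx w (col_mx v N))) =
  Psi (corner_poly (col_mx u (col_mx v N))) + Psi (corner_poly (col_mx w N)).
Proof. by apply; [exact: corner_cutU|exact: corner_cutI]. Qed.

(** The row operations replacing [v], respectively [u], by [w]; their determinants are the volume
    shares of the two pieces. *)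
Let E1 : 'M[R]_(1 + (1 + k)) := block_mx 1%:M 0 (col_mx al%:M 0) (block_mx (1 - al)%:M 0 0 1%:M).
Let E2 : 'M[R]_(1 + (1 + k)) := block_mx al%:M (row_mx (1 - al)%:M 0) 0 1%:M.

Lemma cut1E : col_mx u (col_mx w N) = E1 *m col_mx u (col_mx v N).
Proof.
rewrite /E1 mul_block_col mul1mx mul0mx addr0; congr col_mx.
by rewrite mul_col_mx mul_block_col mul1mx !mul_scalar_mx !mul0mx addr0 add0r add_col_mx add0r.
Qed.

Lemma cut2E : col_mx w (col_mx v N) = E2 *m col_mx u (col_mx v N).
Proof.
by rewrite /E2 mul_block_col mul1mx mul0mx add0r mul_row_col !mul_scalar_mx mul0mx addr0.
Qed.

Lemma det_cut1 : \det E1 = 1 - al.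
Proof. by rewrite /E1 det_lblock det1 mul1r det_lblock det_scalar1 det1 mulr1. Qed.

Lemma det_cut2 : \det E2 = al.
Proof. by rewrite det_ublock det_scalar1 det1 mulr1. Qed.

Lemma cut1_free : row_free (col_mx u (col_mx w N)).
Proof. by rewrite cut1E; apply: row_free_unitl => //; rewrite unitmxE det_cut1 unitfE gt_eqF. Qed.

Lemma cut2_free : row_free (col_mx w (col_mx v N)).
Proof. by rewrite cut2E; apply: row_free_unitl => //; rewrite unitmxE det_cut2 unitfE gt_eqF. Qed.

Lemma cut_free : row_free (col_mx w N).
Proof. exact: row_free_dsub cut1_free. Qed.

End SimplexCut.

(** * Transitivity of SL(n) on simplices *)

Section SLTransitivity.
Context {R : realType}.

Lemma corner_poly_image n k (M : 'M[R]_(k, n)) (G : 'M[R]_n) :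
  polytope0_image G^T (corner_poly M) = corner_poly (M *m G).
Proof.
apply: polytope0_inj; apply/seteqP; split=> [_ [y /cornerP[a [a0 a1 ->]] <-]|x].
  by apply/cornerP; exists a; rewrite trmxK mulmxA.
move=> /cornerP[a [a0 a1 ->]]; exists (a *m M); first by apply/cornerP; exists a.
by rewrite trmxK mulmxA.
Qed.

Lemma SL_corner n k (Psi : polytope0 R n -> R) (M : 'M[R]_(k, n)) (G : 'M[R]_n) :
  sl_invariant Psi -> \det G = 1 -> Psi (corner_poly (M *m G)) = Psi (corner_poly M).
Proof. by move=> sPsi detG; rewrite -corner_poly_image sPsi// det_tr. Qed.

(** The rank factorization extends [M] to an invertible matrix, and one of the spare rows is scaled
    by [c] to correct the determinant. *)
Lemma row_free_SL k d (M : 'M[R]_(k, k + d.+1)) : row_free M ->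
  exists2 G : 'M[R]_(k + d.+1), \det G = 1 & M = pid_mx k *m G.
Proof.
move=> Mfree.
have rM : \rank M = k by apply/eqP.
pose c := (\det (col_ebase M) * \det (row_ebase M))^-1.
pose D : 'M[R]_d.+1 := diag_mx (\row_i if i == 0 then c else 1).
have detD : \det D = c.
  rewrite det_diag big_ord_recl mxE eqxx big1 ?mulr1// => i _.
  by rewrite mxE.
exists (block_mx (col_ebase M) 0 0 D *m row_ebase M).
  rewrite det_mulmx det_ublock detD /c mulrAC mulfV//.
  by rewrite mulf_neq0// -unitfE -unitmxE ?col_ebase_unit ?row_ebase_unit.
have pE : pid_mx k = row_mx 1%:M 0 :> 'M[R]_(k, k + d.+1) by exact: pid_mx_row.
rewrite mulmxA pE mul_row_block mul1mx !mul0mx !addr0 mulmx0.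
rewrite -{1}[M]mulmx_ebase rM pE mul_mx_row mulmx1 mulmx0//.
Qed.

Lemma SL_corner_lt n k (Psi : polytope0 R n -> R) (M M' : 'M[R]_(k, n)) :
  sl_invariant Psi -> (k < n)%N -> row_free M -> row_free M' ->
  Psi (corner_poly M) = Psi (corner_poly M').
Proof.
move=> sPsi kn; have nE : n = (k + (n - k).-1.+1)%N by rewrite prednK ?subn_gt0// subnKC// ltnW.
move: (n - k).-1 nE => d nE; subst n => /row_free_SL[G detG ->] /row_free_SL[G' detG' ->].
by rewrite !SL_corner.
Qed.

Lemma corner_xrow n k (M : 'M[R]_(k, n)) i j : corner_poly (xrow i j M) = corner_poly M.
Proof.
have sub (N : 'M[R]_(k, n)) : corner (xrow i j N) `<=` corner N.
  move=> x /cornerP[a [a0 a1 ->]]; apply/cornerP; exists (xcol i j a); split.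
  - by move=> l; rewrite mxE.
  - rewrite (reindex_inj (@perm_inj _ (tperm i j))).
    by under eq_bigr do rewrite mxE tpermK.
  - by rewrite xrowE xcolE mulmxA.
apply: polytope0_inj; apply/seteqP; split; first exact: sub.
have {1}-> : M = xrow i j (xrow i j M); last exact: sub.
by rewrite !xrowE mulmxA -perm_mxM tperm2 perm_mx1 mul1mx.
Qed.

End SLTransitivity.

Section Classification.
Context {R : realType} {k : nat}.
Notation n := (1 + (1 + k))%N.
Variable Psi : polytope0 R n -> R.
Hypotheses (Psi_SL : sl_invariant Psi) (Psi_val : valuation Psi).

Definition dg (s : R) : 'M[R]_n := block_mx s%:M 0 0 1%:M.

Lemma det_dg s : \det (dg s) = s.
Proof. by rewrite det_ublock det_scalar1 det1 mulr1. Qed.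

(** A positive determinant is factored out on the left, leaving a matrix of determinant 1; a
    negative one is first made positive by exchanging two vertices. *)
Lemma SL_corner_full (M : 'M[R]_n) : row_free M ->
  Psi (corner_poly M) = Psi (corner_poly (dg `|\det M|)).
Proof.
move=> Mfree; have uM : M \in unitmx by rewrite -row_free_unit.
have pos (N : 'M[R]_n) : 0 < \det N -> Psi (corner_poly N) = Psi (corner_poly (dg (\det N))).
  move=> N0; have ud : dg (\det N) \in unitmx by rewrite unitmxE det_dg unitfE gt_eqF.
  have {1}-> : N = dg (\det N) *m (invmx (dg (\det N)) *m N) by rewrite mulKVmx.
  by rewrite SL_corner// det_mulmx det_inv det_dg mulVf// gt_eqF.
have [M0|M0|M0] := ltgtP (\det M) 0.
- rewrite -(@corner_xrow _ _ _ M 0 (lift 0 0)).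
  have dE : \det (xrow 0 (lift 0 0) M) = - \det M.
    by rewrite xrowE det_mulmx det_perm odd_tperm/= expr1 mulN1r.
  by rewrite ltr0_norm// -dE pos// dE oppr_gt0.
- by rewrite gtr0_norm// pos.
- by move: uM; rewrite unitmxE M0 unitr0.
Qed.

Definition flat_value : R := Psi (corner_poly (delta_mx 0 0 : 'M[R]_(1, n))).

(** In the cut identity the whole and both halves are equivalent under SL(n); cancelling leaves the
    value of the common face, one dimension lower. *)
Lemma corner_flat_value m (M : 'M[R]_(m.+1, n)) : (m.+1 < n)%N -> row_free M ->
  Psi (corner_poly M) = flat_value.
Proof.
elim: m M => [|m ih] M mn Mfree.
  apply: SL_corner_lt => //; apply/row_freeP; exists (delta_mx 0 0).
  by rewrite mul_delta_mx [LHS]mx11_scalar mxE.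
change m.+2 with (1 + (1 + m))%N in M, Mfree |- *.
pose u := usubmx M; pose v := usubmx (dsubmx M); pose N := dsubmx (dsubmx M).
have ME : M = col_mx u (col_mx v N) by rewrite !vsubmxK.
rewrite ME in Mfree *.
have half : 0 < (2^-1 : R) < 1 by apply/andP; split; lra.
have := corner_cut_valuation half Mfree Psi_val.
rewrite [X in _ = _ + X]ih; [|exact: ltnW|exact: (cut_free half Mfree)].
rewrite (SL_corner_lt Psi_SL _ (cut1_free half Mfree) Mfree)//.
rewrite (SL_corner_lt Psi_SL _ (cut2_free half Mfree) Mfree)//.
exact: addrI.
Qed.

Lemma dg_additive s t : 0 < s -> 0 < t ->
  Psi (corner_poly (dg s)) + Psi (corner_poly (dg t)) =
  Psi (corner_poly (dg (s + t))) + flat_value.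
Proof.
move=> s0 t0; have st0 : 0 < s + t by exact: addr_gt0.
pose M := dg (s + t).
pose u : 'rV[R]_n := usubmx M; pose v : 'rV[R]_n := usubmx (dsubmx M).
pose N : 'M[R]_(k, n) := dsubmx (dsubmx M).
have ME : M = col_mx u (col_mx v N) by rewrite !vsubmxK.
have Mfree : row_free (col_mx u (col_mx v N)).
  by rewrite -ME row_free_unit unitmxE det_dg unitfE gt_eqF.
(* The ratio that gives the two pieces the determinants [s] and [t]. *)
pose al := s / (s + t).
have al01 : 0 < al < 1.
  by rewrite divr_gt0//= ltr_pdivrMr// mul1r ltrDl.
have := corner_cut_valuation al01 Mfree Psi_val.
rewrite [X in _ = _ + X]corner_flat_value; [|by []|exact: (cut_free al01 Mfree)].
rewrite -ME -/M => <-.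
rewrite (SL_corner_full (cut1_free al01 Mfree)).
rewrite (SL_corner_full (cut2_free al01 Mfree)).
rewrite cut1E cut2E !det_mulmx det_cut1 det_cut2 -ME det_dg addrC.
have -> : al * (s + t) = s by rewrite /al divfK// gt_eqF.
have -> : (1 - al) * (s + t) = t by rewrite mulrBl mul1r /al divfK ?gt_eqF// addrC addKr.
by rewrite !gtr0_norm.
Qed.

End Classification.

(** * Dependence on the determinant *)

Section DilatedSimplex.
Context {R : realType} {k : nat}.
Notation n := (1 + (1 + k))%N.
Notation bT := (g_sigma_algebraType (@open (polytope0 R n))).
Notation mR := (measurableTypeR R).

(** Points with equal weights differ in the first coordinate only; hence [corner_poly (dg s)]
    depends continuously on [s], which transfers measurability to the real line. *)
Lemma enorm_dg_le (a : 'rV[R]_n) s t : (forall i, 0 <= a 0 i) -> \sum_i a 0 i <= 1 ->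
  enorm (a *m dg s - a *m dg t) <= `|s - t|.
Proof.
move=> a0 a1.
have -> : a *m dg s - a *m dg t = (a 0 0 * (s - t)) *: delta_mx 0 0.
  rewrite -mulmxBr /dg opp_block_mx add_block_mx oppr0 addr0 !subrr -raddfB/=.
  rewrite -{1}[a]hsubmxK mul_row_block !mulmx0 !addr0.
  apply/rowP => i; case: (split_ordP i) => j ->.
    rewrite row_mxEl ord1 [lsubmx a]mx11_scalar -scalar_mxM !mxE eqxx mulr1n.
    rewrite (_ : (lshift _ 0 : 'I_n) = 0) ?eqxx ?mulr1//; exact: val_inj.
  by rewrite row_mxEr !mxE (_ : (rshift 1 j == 0) = false) ?andbF ?mulr0.
rewrite enormZ normrM.
have -> : enorm (delta_mx 0 0 : 'rV[R]_n) = 1.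
  rewrite /enorm (bigD1 0)//= big1 => [|i i0]; first by rewrite mxE !eqxx expr1n addr0 sqrtr1.
  by rewrite mxE (negPf i0) andbF expr0n.
rewrite mulr1 ler_piMl// ger0_norm//; apply: le_trans a1.
by rewrite (bigD1 0)//= lerDl sumr_ge0.
Qed.

Lemma measurable_dg : measurable_fun [set: mR] (fun s : mR => corner_poly (dg s) : bT).
Proof.
apply: (@measurability _ _ mR bT setT (fun s => corner_poly (dg s)) (@open (polytope0 R n))) => // _ [U oU <-]; rewrite setTI.
apply: open_measurable; rewrite openE => s Us.
have := open_nbhs_nbhs (conj oU Us) => /nbhs_ballP[e /= e0 eU].
apply/nbhs_ballP; exists e => // t; rewrite /ball/= => st; apply: eU.
apply: (polytope0_ball (normr_ge0 (s - t)) st).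
  move=> x /cornerP[a [a0 a1 ->]]; exists (a *m dg t); last exact: enorm_dg_le.
  by apply/cornerP; exists a.
move=> x /cornerP[a [a0 a1 ->]]; exists (a *m dg s); last exact: enorm_dg_le.
by apply/cornerP; exists a.
Qed.

Lemma dg_affine (Psi : polytope0 R n -> R) :
  borel_measurable Psi -> sl_invariant Psi -> valuation Psi ->
  exists c, forall s, 0 < s -> Psi (corner_poly (dg s)) = flat_value Psi + s * c.
Proof.
move=> bPsi sPsi vPsi.
pose g s := Psi (corner_poly (dg s)) - flat_value Psi.
exists (g 1) => s s0; rewrite -(@measurable_pos_additive _ g) ?/g//.
- by rewrite addrC subrK.
- apply: measurable_funB; last exact: measurable_cst.
  have /borel_measurableP mPsi := bPsi.
  exact: (measurableT_comp mPsi measurable_dg).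
- move=> x y x0 y0; have := dg_additive sPsi vPsi x0 y0; lra.
Qed.

Lemma volume_hyperplane (P : polytope0 R n) : (forall x, (P : set _) x -> x 0 0 = 0) -> volume P = 0.
Proof.
move=> P0; have [K K0 PK] := polytope0_box P.
pose K' (i : 'I_n) := if i == 0 then 0 else K.
have PK' : (P : set _) `<=` box (fun i => - K' i) K'.
  move=> x Px i; rewrite /K'; case: eqVneq => [->|_]; last exact: PK.
  by rewrite P0// oppr0 lexx.
rewrite volumeE (_ : vol P = 0%E)//; apply/eqP; rewrite eq_le measure_ge0 andbT.
apply: le_trans (le_vol (rmeas_polytope0 P) (rmeas_box _ _) PK') _.
rewrite vol_box => [|i]; last by rewrite /K'; case: ifP; rewrite ?oppr0// lerNl (le_trans _ K0)// oppr_le0.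
by rewrite big_ord_recl /K' eqxx oppr0 subr0 mul0r.
Qed.

(** The segment on the first axis is moved to another axis by SL(n), where the first coordinate
    vanishes. *)
Lemma volume_flat : flat_value (fun P : polytope0 R n => volume P) = 0.
Proof.
pose M : 'M[R]_(1, n) := delta_mx 0 (lift ord0 0).
rewrite /flat_value (_ : volume _ = volume (corner_poly M)).
  apply: volume_hyperplane => x /cornerP[a [_ _ ->]].
  by rewrite mxE big_ord1 mxE mulr0.
have free (j : 'I_n) : row_free (delta_mx 0 j : 'M[R]_(1, n)).
  apply/row_freeP; exists (delta_mx j 0).
  by rewrite mul_delta_mx [LHS]mx11_scalar mxE.
exact: (@SL_corner_lt R n 1 (fun P => volume P) (delta_mx 0 0) M (@volume_SL R n) isT (free _) (free _)).
Qed.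

Lemma volume_dg1 : 0 < volume (corner_poly (dg 1 : 'M[R]_n)).
Proof.
(* The cube of side 1/n satisfies the bound on the sum of coordinates. *)
pose e : R := n%:R^-1.
have e0 : 0 < e by rewrite invr_gt0.
have sub : box (fun=> 0) (fun _ : 'I_n => e) `<=` corner (dg 1).
  move=> x xe; apply/cornerP; exists x; split.
  - by move=> i; have /andP[] := xe i.
  - apply: (@le_trans _ _ (\sum_(i < n) e)); first by apply: ler_sum => i _; have /andP[] := xe i.
    by rewrite sumr_const card_ord -[e *+ _]mulr_natl divff.
  - by rewrite /dg -scalar_mx_block mulmx1.
rewrite volumeE -lte_fin fineK ?vol_polytope0_fin//.
apply: (@lt_le_trans _ _ (vol (box (fun=> 0) (fun _ : 'I_n => e)))).
  rewrite vol_box => [|i]; last exact: ltW.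
  by rewrite lte_fin prodr_gt0// => i _; rewrite subr0.
by apply: (le_vol _ _ sub); [exact: rmeas_box|exact: (rmeas_polytope0 (corner_poly (dg 1)))].
Qed.

End DilatedSimplex.

Section Main.
Context {R : realType} {k : nat}.
Notation n := (1 + (1 + k))%N.
Notation bT := (g_sigma_algebraType (@open (polytope0 R n))).

Lemma valuation_cst : valuation (fun _ : polytope0 R n => 1 : R).
Proof. by []. Qed.

Lemma valuation_lincomb (a b c : R) (Psi1 Psi2 Psi3 : polytope0 R n -> R) :
  valuation Psi1 -> valuation Psi2 -> valuation Psi3 ->
  valuation (fun P => a * Psi1 P + b * Psi2 P + c * Psi3 P).
Proof.
move=> v1 v2 v3 P Q PQ PnQ E F.
have e1 := v1 _ _ _ _ E F; have e2 := v2 _ _ _ _ E F; have e3 := v3 _ _ _ _ E F.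
transitivity (a * (Psi1 P + Psi1 Q) + b * (Psi2 P + Psi2 Q) + c * (Psi3 P + Psi3 Q)).
  by ring.
by rewrite e1 e2 e3; ring.
Qed.

(** By independence, the opposite of a vertex has no representation with nonnegative weights. *)
Lemma omega_corner m (M : 'M[R]_(m.+1, n)) : row_free M -> omega (corner_poly M) = 0.
Proof.
move=> Mfree; apply: omega_nsym => sM.
have M0 : ray (corner_poly M) (row 0 M).
  by apply: ray_sub; exact: (fcorner_vertex (fun i => row i M)).
have [t t0 /cornerP[a [a0 _]]] := sM _ M0.
rewrite scalerN -scaleNr rowE scalemxAl => /(row_free_inj Mfree) aE.
have := a0 0; rewrite -aE !mxE !eqxx mulr1 oppr_ge0 leNgt t0//.
Qed.

Lemma omega_corner0 (M : 'M[R]_(0, n)) : omega (corner_poly M) = 1.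
Proof.
have x0 x : corner M x -> x = 0 by move=> /cornerP[a [_ _ ->]]; rewrite [M]flatmx0 mulmx0.
rewrite omega_sym => [|x [t t0 /x0 tx]]; last first.
  exists t => //; rewrite scalerN tx oppr0; exact: polytope0_0.
rewrite /= (affine_dimE (affine_hull_corner M)).
by rewrite (size0nil (size_tuple _)) span_nil dimv0.
Qed.

Theorem SL_valuation_formula (Psi : polytope0 R n -> R) :
  borel_measurable Psi -> sl_invariant Psi -> valuation Psi ->
  exists c0 c0' cn : R, forall P : polytope0 R n,
    Psi P = c0 * euler_char P + c0' * omega P + cn * volume P.
Proof.
move=> bPsi sPsi vPsi.
have [g gE] := dg_affine bPsi sPsi vPsi.
have [h hE] := dg_affine (@volume_borel R n) (@volume_SL R n) (@volume_valuation R n).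
have {}hE s : 0 < s -> volume (corner_poly (dg s : 'M[R]_n)) = s * h.
  by move=> /hE; rewrite volume_flat add0r.
have h0 : 0 < h by have := @volume_dg1 R k; rewrite hE// mul1r.
have charE (P : polytope0 R n) : euler_char P = 1 :> R.
  by rewrite /euler_char ifT//; apply/asboolP; exists 0; exact: polytope0_0.
pose M0 : 'M[R]_(0, n) := 0.
(* [c0] is read off the segments, [c0'] corrects the value at {0}, and [cn] is the slope of [Psi] in
   units of the slope of the volume. *)
pose c0 := flat_value Psi; pose c0' := Psi (corner_poly M0) - c0; pose cn := g / h.
exists c0, c0', cn => P; rewrite charE.
pose Phi Q : R := Psi Q - (c0 * 1 + c0' * omega Q + cn * volume Q).
suff : Phi P = 0 by move/eqP; rewrite subr_eq0 => /eqP.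
apply: valuation_simplices_eq0 => [|m M Mfree].
  have vF : valuation (fun Q : polytope0 R n => c0 * 1 + c0' * omega Q + cn * volume Q).
    exact (valuation_lincomb c0 c0' cn valuation_cst (@omega_valuation R n) (@volume_valuation R n)).
  have := valuation_lincomb 1 (-1) 0 vPsi vF vPsi; congr valuation.
  by apply/funext => Q; rewrite mul1r mulN1r mul0r addr0.
rewrite /Phi; case: m M Mfree => [|m] M Mfree.
  rewrite omega_corner0 volume_hyperplane => [|x /cornerP[a [_ _ ->]]]; last first.
    by rewrite [a]thinmx0 mul0mx mxE.
  by rewrite [M]flatmx0 -/M0 /c0'; ring.
rewrite omega_corner//.
have mn : (m.+1 <= n)%N by rewrite -(eqP Mfree) rank_leq_col.
move: mn; rewrite leq_eqVlt => /orP[/eqP mn|mn].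
  have {}mn : m = (1 + k)%N by case: mn.
  subst m; change (1 + k).+1 with (1 + (1 + k))%N in M, Mfree |- *.
  have M_gt0 : 0 < `|\det M|.
    by rewrite normr_gt0 -unitfE -unitmxE -row_free_unit.
  rewrite (SL_corner_full sPsi Mfree) gE//.
  have := SL_corner_full (@volume_SL R n) Mfree => /= ->; rewrite hE// /c0 /cn.
  by field; rewrite gt_eqF.
rewrite (corner_flat_value sPsi vPsi)//.
have := corner_flat_value (@volume_SL R n) (@volume_valuation R n) mn Mfree; rewrite volume_flat => ->.
by rewrite /c0; ring.
Qed.

End Main.

Unset Implicit Arguments.

Theorem corollary1p1 (R : realType) (n : nat) (n_ge2 : (2 <= n)%N)
    (Psi : polytope0 R n -> R) :
  [/\ borel_measurable Psi, sl_invariant Psi & valuation Psi] <->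
  exists c0 c0' cn : R, forall P : polytope0 R n,
    Psi P = c0 * euler_char P
          + c0' * (-1) ^+ affine_dim P * \1_(relint P) (0 : 'rV[R]_n)
          + cn * volume P.
Proof.
case: n n_ge2 Psi => [|[|k]]// _ Psi; split=> [[bPsi sPsi vPsi]|[c0 [c0' [cn PsiE]]]].
  have [c0 [c0' [cn PsiE]]] := SL_valuation_formula bPsi sPsi vPsi.
  by exists c0, c0', cn => P; rewrite PsiE /omega mulrA.
have {PsiE}-> : Psi = fun P => c0 * 1 + c0' * omega P + cn * volume P.
  apply/funext => P; rewrite PsiE /omega mulrA; congr (_ * _ + _ + _).
  by rewrite /euler_char ifT//; apply/asboolP; exists 0; exact: polytope0_0.
split.
- apply/borel_measurableP; apply: measurable_funD; first apply: measurable_funD.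
  + exact: measurable_cst.
  + apply: measurable_funM; first exact: measurable_cst.
    by apply/borel_measurableP; exact: omega_borel.
  + apply: measurable_funM; first exact: measurable_cst.
    by apply/borel_measurableP; exact: volume_borel.
- move=> A detA P; rewrite (omega_SL detA P).
  by have := volume_SL detA P => /= ->.
- exact (valuation_lincomb c0 c0' cn (@valuation_cst R k) (@omega_valuation R _) (@volume_valuation R _)).
Qed.
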